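(* Let $A$ be an element of $\mathrm{PGL}_3(\mathbb{C})$ whose coefficients are algebraically independent over $\mathbb{Q}$. Then the centralizer of $A\sigma$ in $\mathrm{Bir}(\mathbb{P}^2(\mathbb{C}))$ is isomorphic to $\mathbb{Z}$.
   Context: $\mathrm{Bir}(\mathbb{P}^2(\mathbb{C}))$ is the group of birational maps of $\mathbb{P}^2(\mathbb{C})$ to itself and $\sigma=(x_1x_2:x_0x_2:x_0x_1)$ is the standard Cremona involution. An element of $\mathrm{PGL}_3(\mathbb{C})$ has coefficients algebraically independent over $\mathbb{Q}$ if it has a representative in $\mathrm{GL}_3(\mathbb{C})$ whose nine entries are algebraically independent over $\mathbb{Q}$. *)

(* Defs.v *)
From HB Require Import structures.
From mathcomp Require Import all_boot all_order all_algebra.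
From mathcomp Require Import generic_quotient.
From mathcomp Require Import boolp classical_sets functions reals.
From mathcomp Require Import complex mpoly.

Set Implicit Arguments.
Unset Strict Implicit.
Unset Printing Implicit Defensive.

Import GRing.Theory.

Local Open Scope quotient_scope.
Local Open Scope ring_scope.

Section RationalMaps.
Variable K : fieldType.

(* A triple (f_0, f_1, f_2) of polynomials in x_0, x_1, x_2, standing for the *)
(* map (f_0 : f_1 : f_2).                                                     *)
Definition triple : Type := 3.-tuple {mpoly K[3]}.
HB.instance Definition _ := Choice.on triple.

Implicit Types f g h : triple.

Definition is_ratmap f : Prop :=
  (exists i, tnth f i != 0) /\
  (exists d : nat, forall i, tnth f i \is d.-homog).

Definition same_ratmap f g : bool :=
  [forall i, forall j, tnth f i * tnth g j == tnth f j * tnth g i].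

Definition triple_comp f g : triple := [tuple tnth f i \mPo g | i < 3].

Definition triple_id : triple := [tuple 'X_i | i < 3].

(* The composite of two rational maps is a rational map only when the         *)
(* substituted triple is nonzero, hence the is_ratmap conditions on it.       *)
Definition birational f : Prop :=
  is_ratmap f /\
  exists g, [/\ is_ratmap g,
                is_ratmap (triple_comp f g),
                same_ratmap (triple_comp f g) triple_id,
                is_ratmap (triple_comp g f)
              & same_ratmap (triple_comp g f) triple_id].

Lemma same_ratmapP f g :
  reflect (forall i j, tnth f i * tnth g j = tnth f j * tnth g i)
          (same_ratmap f g).
Proof.
by apply: (iffP 'forall_forallP) => H i j; [apply/eqP: (H i j)|apply/eqP].
Qed.

Lemma same_refl f : same_ratmap f f.
Proof. by apply/same_ratmapP => i j; rewrite mulrC. Qed.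

Lemma same_symm f g : same_ratmap f g -> same_ratmap g f.
Proof.
move=> /same_ratmapP H; apply/same_ratmapP => i j.
by rewrite mulrC -H mulrC.
Qed.

Lemma same_trans f g h : is_ratmap g ->
  same_ratmap f g -> same_ratmap g h -> same_ratmap f h.
Proof.
move=> [[k gk] _] /same_ratmapP fg /same_ratmapP gh; apply/same_ratmapP => i j.
apply: (mulfI gk); apply: (mulfI gk).
have E (x y z : {mpoly K[3]}) : x * (x * (y * z)) = (y * x) * (x * z).
  by rewrite [y * x]mulrC -!mulrA; congr (_ * _); rewrite mulrCA.
by rewrite !E (fg i k) (fg j k) (gh k j) (gh k i) mulrACA.
Qed.

Lemma same_scale f g : is_ratmap f -> is_ratmap g -> same_ratmap f g ->
  exists a b : {mpoly K[3]}, [/\ a != 0, b != 0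
    & forall i, a * tnth f i = b * tnth g i].
Proof.
move=> [[i fi] _] [[j gj] _] /same_ratmapP fg.
exists (tnth g j), (tnth f j); split=> //; last first.
  by move=> k; rewrite mulrC fg.
by apply: contra_neq (mulf_neq0 fi gj) => fj0; rewrite fg fj0 mul0r.
Qed.

Lemma comp_homog (p : {mpoly K[3]}) d g e :
  p \is d.-homog -> (forall i, tnth g i \is e.-homog) ->
  p \mPo g \is (d * e)%N.-homog.
Proof.
move=> /dhomogP pd ge; rewrite comp_mpolyE big_seq rpred_sum // => m /pd mE.
apply: dhomogZ; rewrite -mE /= mdegE big_distrl /=.
elim/big_rec2: _ => [|i x y _ Hy]; first exact: dhomog1.
by apply: dhomogM => //; rewrite mulnC; apply: dhomogMn.
Qed.

Lemma comp_scale (p q : {mpoly K[3]}) d g :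
  p \is d.-homog ->
  p \mPo [tuple q * tnth g i | i < 3] = q ^+ d * (p \mPo g).
Proof.
move=> /dhomogP pd; rewrite !comp_mpolyE mulr_sumr.
apply: eq_big_seq => m /pd mE; rewrite -scalerAr; congr (_ *: _).
rewrite -mE /= mdegE -prodrXr -big_split /=.
by apply: eq_bigr => i _; rewrite tnth_mktuple exprMn.
Qed.

Lemma comp_comp (p : {mpoly K[3]}) g h :
  p \mPo triple_comp g h = (p \mPo g) \mPo h.
Proof.
rewrite [p \mPo g]comp_mpolyE raddf_sum /= comp_mpolyE.
apply: eq_bigr => m _; rewrite comp_mpolyZ rmorph_prod /=.
by congr (_ *: _); apply: eq_bigr => i _; rewrite tnth_mktuple rmorphXn.
Qed.

Lemma triple_compA f g h :
  triple_comp f (triple_comp g h) = triple_comp (triple_comp f g) h.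
Proof. by apply: eq_from_tnth => i; rewrite !tnth_mktuple comp_comp. Qed.

Lemma triple_comp1 f : triple_comp f triple_id = f.
Proof. by apply: eq_from_tnth => i; rewrite tnth_mktuple comp_mpoly_id. Qed.

Lemma triple_1comp f : triple_comp triple_id f = f.
Proof.
by apply: eq_from_tnth => i; rewrite !tnth_mktuple comp_mpolyXU -tnth_nth.
Qed.

Lemma mpolyX_eq0 (m : 'X_{1..3}) : ('X_[m] == 0 :> {mpoly K[3]}) = false.
Proof.
apply/eqP => /(congr1 (mcoeff m)) /eqP.
by rewrite mcoeffX eqxx mcoeff0 oner_eq0.
Qed.

Lemma is_ratmap_id : is_ratmap triple_id.
Proof.
split; first by exists 0; rewrite tnth_mktuple mpolyX_eq0.
by exists 1%N => i; rewrite tnth_mktuple dhomogX /= mdeg1.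
Qed.

Lemma bir_dominant (p : {mpoly K[3]}) d g : birational g ->
  p \is d.-homog -> p \mPo g = 0 -> p = 0.
Proof.
move=> [_ [h [_ rgh gh _ _]]] pd pg0.
have [a [b [a0 b0 ab]]] := same_scale rgh is_ratmap_id gh.
have : [tuple a * tnth (triple_comp g h) i | i < 3]
     = [tuple b * tnth triple_id i | i < 3].
  by apply: eq_from_tnth => i; rewrite tnth_mktuple ab [RHS]tnth_mktuple.
move=> /(congr1 (fun t => p \mPo t)); rewrite !(comp_scale _ _ pd).
rewrite comp_comp pg0 comp_mpoly0 mulr0 comp_mpoly_id => /esym/eqP.
by rewrite mulf_eq0 expf_eq0 (negPf b0) andbF /= => /eqP.
Qed.

Lemma is_ratmap_comp f g :
  is_ratmap f -> birational g -> is_ratmap (triple_comp f g).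
Proof.
move=> [[i fi] [d fd]] bg; split.
  exists i; rewrite tnth_mktuple; apply: contra_neq fi.
  exact: bir_dominant bg (fd i).
case: (bg) => -[_ [e ge]] _; exists (d * e)%N => j.
by rewrite tnth_mktuple comp_homog.
Qed.

Lemma same_compl f f' g :
  same_ratmap f f' -> same_ratmap (triple_comp f g) (triple_comp f' g).
Proof.
move=> /same_ratmapP ff; apply/same_ratmapP => i j.
by rewrite !tnth_mktuple -!rmorphM /= ff.
Qed.

Lemma same_compr f g g' : is_ratmap f -> is_ratmap g -> is_ratmap g' ->
  same_ratmap g g' -> same_ratmap (triple_comp f g) (triple_comp f g').
Proof.
move=> [_ [d fd]] rg rg' gg; have [a [b [a0 b0 ab]]] := same_scale rg rg' gg.
have abE : [tuple a * tnth g i | i < 3] = [tuple b * tnth g' i | i < 3].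
  by apply: eq_from_tnth => i; rewrite !tnth_mktuple.
have E i : a ^+ d * (tnth f i \mPo g) = b ^+ d * (tnth f i \mPo g').
  by rewrite -!comp_scale // abE.
apply/same_ratmapP => i j; rewrite !tnth_mktuple.
by apply: (mulfI (expf_neq0 d a0)); rewrite !mulrA !E mulrAC.
Qed.

Lemma birational_id : birational triple_id.
Proof.
split; first exact: is_ratmap_id.
by exists triple_id; rewrite !triple_comp1; split=> //;
  [exact: is_ratmap_id|exact: is_ratmap_id|exact: same_refl|
   exact: is_ratmap_id|exact: same_refl].
Qed.

Lemma birational_inv_ex f : birational f ->
  exists g, [/\ birational g, same_ratmap (triple_comp f g) triple_id
              & same_ratmap (triple_comp g f) triple_id].
Proof. by move=> [rf [g [rg rfg fg rgf gf]]]; exists g; split=> //; split=> //; exists f. Qed.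

Lemma comp_inv f f' g g' :
  birational f -> birational g -> birational f' -> birational g' ->
  same_ratmap (triple_comp f f') triple_id ->
  same_ratmap (triple_comp g g') triple_id ->
  same_ratmap (triple_comp (triple_comp f g) (triple_comp g' f')) triple_id.
Proof.
move=> bf bg bf' bg' ff gg.
have rf := proj1 bf; have rf' := proj1 bf'.
have rg := proj1 bg; have rg' := proj1 bg'.
rewrite -triple_compA [triple_comp g _]triple_compA.
apply: (@same_trans _ (triple_comp f f')) => //; first exact: is_ratmap_comp.
apply: same_compr => //.
  by apply: is_ratmap_comp => //; apply: is_ratmap_comp.
by rewrite -[X in same_ratmap _ X]triple_1comp; apply: same_compl.
Qed.

Lemma birational_comp f g :
  birational f -> birational g -> birational (triple_comp f g).
Proof.
move=> bf bg; have [f' [bf' ff' f'f]] := birational_inv_ex bf.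
have [g' [bg' gg' g'g]] := birational_inv_ex bg.
have [rf rf' rg rg'] : [/\ is_ratmap f, is_ratmap f', is_ratmap g & is_ratmap g'].
  by split; [case: bf|case: bf'|case: bg|case: bg'].
split; first exact: is_ratmap_comp.
exists (triple_comp g' f'); split; [exact: is_ratmap_comp| |exact: comp_inv
  | |exact: comp_inv].
  by rewrite triple_compA; do 2!apply: is_ratmap_comp => //;
     rewrite -?triple_compA; apply: is_ratmap_comp.
by rewrite triple_compA; do 2!apply: is_ratmap_comp => //;
     rewrite -?triple_compA; apply: is_ratmap_comp.
Qed.

Record bir_triple : Type := BirTriple {
  bir_val :> triple;
  bir_valP : `[< birational bir_val >] }.

HB.instance Definition _ := [isSub for bir_val].
HB.instance Definition _ := [Choice of bir_triple by <:].

Lemma bir_birational (f : bir_triple) : birational f.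
Proof. exact/asboolP/bir_valP. Qed.

Definition mk_bir f (bf : birational f) : bir_triple := BirTriple (asboolT bf).

Definition bir_equiv (f g : bir_triple) : bool := same_ratmap f g.

Lemma bir_equiv_refl : reflexive bir_equiv.
Proof. by move=> f; apply: same_refl. Qed.

Lemma bir_equiv_sym : ssrbool.symmetric bir_equiv.
Proof. by move=> f g; apply/idP/idP; apply: same_symm. Qed.

Lemma bir_equiv_trans : transitive bir_equiv.
Proof. by move=> g f h; apply: same_trans; case: (bir_birational g). Qed.

Canonical bir_equiv_rel :=
  EquivRel bir_equiv bir_equiv_refl bir_equiv_sym bir_equiv_trans.

(* The Cremona group Bir(P^2(K)). *)
Definition Bir : Type := {eq_quot bir_equiv}.
HB.instance Definition _ := Choice.on Bir.
HB.instance Definition _ := EqQuotient.on Bir.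

Definition bir_class f (bf : birational f) : Bir := \pi_Bir (mk_bir bf).

Lemma bir_classP f g (bf : birational f) (bg : birational g) :
  reflect (bir_class bf = bir_class bg) (same_ratmap f g).
Proof. by apply: (iffP idP) => [fg|/eqmodP//]; apply/eqmodP. Qed.

Lemma bir_classW (P : Bir -> Prop) :
  (forall f (bf : birational f), P (bir_class bf)) -> forall x, P x.
Proof.
move=> H x; rewrite -[x]reprK; move: (H _ (bir_birational (repr x))).
by congr (P _); congr (\pi_Bir _); apply: val_inj.
Qed.

Definition bir_one : Bir := bir_class birational_id.

(* x * y is the composite x o y.                                             *)
Definition bir_mul (x y : Bir) : Bir :=
  bir_class (birational_comp (bir_birational (repr x)) (bir_birational (repr y))).

Definition bir_inv (x : Bir) : Bir :=
  let e := cid (birational_inv_ex (bir_birational (repr x))) in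
  bir_class (let: And3 bg _ _ := projT2 e in bg).

Lemma repr_class f (bf : birational f) : same_ratmap (repr (bir_class bf)) f.
Proof. by have /eqmodP : repr (bir_class bf) = mk_bir bf %[mod Bir] by rewrite reprK. Qed.

Lemma bir_mulE f g (bf : birational f) (bg : birational g) :
  bir_mul (bir_class bf) (bir_class bg) = bir_class (birational_comp bf bg).
Proof.
have [b1 b2] := (bir_birational (repr (bir_class bf)),
                 bir_birational (repr (bir_class bg))).
apply/bir_classP.
apply: (@same_trans _ (triple_comp f (repr (bir_class bg)))).
- exact: is_ratmap_comp (proj1 bf) b2.
- exact/same_compl/repr_class.
- by apply: same_compr (proj1 bf) (proj1 b2) (proj1 bg) (repr_class _).
Qed.

Lemma bir_mulA : associative bir_mul.
Proof.
elim/bir_classW=> f bf; elim/bir_classW=> g bg; elim/bir_classW=> h bh.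
by rewrite !bir_mulE; apply/bir_classP; rewrite triple_compA same_refl.
Qed.

Lemma bir_mul1 : left_id bir_one bir_mul.
Proof.
elim/bir_classW=> f bf.
by rewrite bir_mulE; apply/bir_classP; rewrite triple_1comp same_refl.
Qed.

Lemma bir_1mul : right_id bir_one bir_mul.
Proof.
elim/bir_classW=> f bf.
by rewrite bir_mulE; apply/bir_classP; rewrite triple_comp1 same_refl.
Qed.

Lemma bir_reprK (x : Bir) : bir_class (bir_birational (repr x)) = x.
Proof. by rewrite -[RHS]reprK; congr (\pi_Bir _); apply: val_inj. Qed.

Lemma bir_mulV : left_inverse bir_one bir_inv bir_mul.
Proof.
move=> x; rewrite -{2}[x]bir_reprK /bir_inv.
case: cid => g /= [bg fg gf]; rewrite bir_mulE; exact/bir_classP.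
Qed.

Lemma bir_Vmul : right_inverse bir_one bir_inv bir_mul.
Proof.
move=> x; rewrite -{1}[x]bir_reprK /bir_inv.
case: cid => g /= [bg fg gf]; rewrite bir_mulE; exact/bir_classP.
Qed.

HB.instance Definition _ :=
  isGroup.Build Bir bir_mulA bir_mul1 bir_1mul bir_mulV bir_Vmul.

Definition sigma_triple : triple :=
  [tuple 'X_1 * 'X_2%:R; 'X_0 * 'X_2%:R; 'X_0 * 'X_1].

Lemma birational_sigma : birational sigma_triple.
Proof.
have i3 (i : 'I_3) : [|| i == 0, i == 1 | i == 2%:R] by case: i => -[|[|[]]].
have rs : is_ratmap sigma_triple.
  split; first by exists 0; rewrite (tnth_nth 0) /= mulf_neq0 ?mpolyX_eq0 //.
  exists 2%N => i; have /or3P[] := i3 i => /eqP->; rewrite (tnth_nth 0) /=;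
  by rewrite -mpolyXD dhomogX /= mdegD !mdeg1.
pose q : {mpoly K[3]} := 'X_0 * 'X_1 * 'X_2%:R.
have q0 : q != 0 by rewrite !mulf_neq0 ?mpolyX_eq0 //.
have ss : triple_comp sigma_triple sigma_triple = [tuple q * 'X_i | i < 3].
  apply: eq_from_tnth => i; rewrite !tnth_mktuple.
  have /or3P[] := i3 i => /eqP->; rewrite (tnth_nth 0) /= rmorphM /=
    !comp_mpolyXU /= /q.
  - by rewrite mulrC mulrCA mulrC.
  - by rewrite mulrC !mulrA mulrAC.
  - by rewrite mulrA; congr (_ * _); rewrite mulrC mulrA.
have rss : is_ratmap (triple_comp sigma_triple sigma_triple).
  rewrite ss; split; first by exists 0; rewrite tnth_mktuple mulf_neq0 ?mpolyX_eq0 //.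
  exists 4%N => i; rewrite tnth_mktuple /q -!mpolyXD dhomogX /=.
  by rewrite !mdegD !mdeg1.
have sss : same_ratmap (triple_comp sigma_triple sigma_triple) triple_id.
  by apply/same_ratmapP => i j; rewrite ss !tnth_mktuple mulrAC.
by split=> //; exists sigma_triple.
Qed.

(* The standard Cremona involution (x_1 x_2 : x_0 x_2 : x_0 x_1). *)
Definition sigma : Bir := bir_class birational_sigma.

(* The map x |-> M x, for x a column vector of homogeneous coordinates. *)
Definition linear_triple (M : 'M[K]_3) : triple :=
  [tuple \sum_(j < 3) M i j *: 'X_j | i < 3].

Lemma linear_triple1 : linear_triple 1%:M = triple_id.
Proof.
apply: eq_from_tnth => i; rewrite !tnth_mktuple (bigD1 i) //= big1 ?addr0.
  by rewrite mxE eqxx scale1r.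
by move=> j ji; rewrite mxE eq_sym (negPf ji) scale0r.
Qed.

Lemma linear_tripleM M N :
  linear_triple (M *m N) = triple_comp (linear_triple M) (linear_triple N).
Proof.
apply: eq_from_tnth => i; rewrite !tnth_mktuple raddf_sum /=.
under [RHS]eq_bigr => j _ do
  rewrite comp_mpolyZ comp_mpolyXU -tnth_nth tnth_mktuple scaler_sumr.
rewrite exchange_big; apply: eq_bigr => k _; rewrite mxE scaler_suml.
by apply: eq_bigr => j _; rewrite scalerA.
Qed.

Lemma is_ratmap_linear M : M \in unitmx -> is_ratmap (linear_triple M).
Proof.
move=> uM; split; last first.
  exists 1%N => i; rewrite tnth_mktuple rpred_sum // => j _.
  by apply: dhomogZ; rewrite -[_ \is _]/('X_j \is 1.-homog) dhomogX /= mdeg1.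
apply: contrapT => /forallNP M0.
have T0 i : tnth (linear_triple M) i = 0 by apply/eqP/negPn/negP/M0.
have := linear_tripleM (invmx M) M; rewrite mulVmx // linear_triple1.
move=> /(congr1 (fun t => tnth t 0)); rewrite !tnth_mktuple raddf_sum /= big1.
  by move=> /eqP; rewrite mpolyX_eq0.
by move=> j _; rewrite comp_mpolyZ comp_mpolyXU -tnth_nth T0 scaler0.
Qed.

Lemma birational_linear M : M \in unitmx -> birational (linear_triple M).
Proof.
move=> uM; split; first exact: is_ratmap_linear.
exists (linear_triple (invmx M)); rewrite -!linear_tripleM mulVmx ?mulmxV //.
rewrite linear_triple1 same_refl; split=> //; try exact: is_ratmap_id.
by apply: is_ratmap_linear; rewrite unitmx_inv.
Qed.

Definition GL3 : Type := {M : 'M[K]_3 | M \in unitmx}.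
HB.instance Definition _ := Choice.on GL3.

Definition proportional (M N : GL3) : bool :=
  `[< exists2 c : K, c != 0 & val N = c *: val M >].

Lemma proportional_refl : reflexive proportional.
Proof. by move=> M; apply/asboolP; exists 1; rewrite ?oner_neq0 ?scale1r. Qed.

Lemma proportional_sym : ssrbool.symmetric proportional.
Proof.
move=> M N; apply/asboolP/asboolP=> -[c c0 E];
by exists c^-1; rewrite ?invr_eq0 // E scalerA mulVf ?scale1r.
Qed.

Lemma proportional_trans : transitive proportional.
Proof.
move=> N M P /asboolP[c c0 E] /asboolP[d d0 F]; apply/asboolP.
by exists (d * c); rewrite ?mulf_neq0 // F E scalerA.
Qed.

Canonical proportional_rel :=
  EquivRel proportional proportional_refl proportional_sym proportional_trans.

Definition PGL3 : Type := {eq_quot proportional}.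
HB.instance Definition _ := Choice.on PGL3.
HB.instance Definition _ := EqQuotient.on PGL3.

Definition gl_bir (M : GL3) : Bir := bir_class (birational_linear (valP M)).

(* The inclusion of PGL_3(K) in Bir(P^2(K)). *)
Definition pgl_bir (A : PGL3) : Bir := gl_bir (repr A).

Lemma pgl_birE (M : GL3) : pgl_bir (\pi_PGL3 M) = gl_bir M.
Proof.
apply/bir_classP; have /eqmodP : repr (\pi_PGL3 M) = M %[mod PGL3] by rewrite reprK.
move=> /asboolP[c c0 ->]; apply/same_ratmapP => i j; rewrite !tnth_mktuple.
have E k : \sum_l (c *: val (repr (\pi_PGL3 M))) k l *: 'X_l
   = c *: \sum_l val (repr (\pi_PGL3 M)) k l *: ('X_l : {mpoly K[3]}).
  by rewrite scaler_sumr; apply: eq_bigr => l _; rewrite scalerA mxE.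
by rewrite !E -!scalerAr mulrC.
Qed.

End RationalMaps.

Definition alg_independent_over_Q (F : numFieldType) n (v : 'I_n -> F) : Prop :=
  forall p : {mpoly rat[n]}, mmap ratr v p = 0 -> p = 0.

(* A class has algebraically independent coefficients when one of its         *)
(* representatives does: mxvec lists the nine entries of M.                   *)
Definition pgl_alg_independent (F : numFieldType) (A : PGL3 F) : Prop :=
  exists2 M : GL3 F, A = \pi_(PGL3 F) M
    & alg_independent_over_Q (fun k => mxvec (val M) 0 k).

Definition centralizer (G : groupType) (x : G) : set G :=
  [set y | commute x y]%classic.

Definition isomorphic_to_Z (G : groupType) (H : set G) : Prop :=
  exists phi : int -> G,
    {morph phi : m n / (m + n)%R >-> (m * n)%g} /\ set_bij setT H phi.

(* Main.v *)
From HB Require Import structures.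
Require Import Defs.
From mathcomp Require Import all_boot all_order all_algebra.
From mathcomp Require Import generic_quotient boolp classical_sets functions.
From mathcomp Require Import mpoly ring zify.
From mathcomp Require Import reals complex.

(* Write f = A sigma, and let deg z be the degree of a triple of coprime forms
   representing z. Passing from z to f z drops from the composite a common factor
   of degree 2 deg z - deg (f z), made of curves that z contracts to base points of
   f. Since A is generic, the points f^-k(e_i) and f^k(A e_i) are pairwise distinct;
   hence the curves dropped along (f^k z)_k and (f^-k z)_k are contracted by z to
   distinct points, and their product divides the Jacobian of z. This bounds the
   total drop by 3 (deg z - 1), so that, for all N,
     2^N (deg z + 3) <= 2 (deg (f^N z) + deg (f^-N z)).
   It also follows that deg (f^N z) is eventually a 2^N.
     Let z commute with f. For N large, representatives G, H of f^N z and f^N z^-1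
   commute with f as polynomial maps, so the common factor C dropped from G H
   satisfies C(f) = k C^2; such a C is constant. Therefore
   deg (f^N z) deg (f^N z^-1) = 4^N, so deg (f^N z) = 2^(N+a) and likewise
   deg (f^-N z) = 2^(N+b) for integers a, b. After exchanging z and z^-1 we have
   a + b <= 0, and the inequality above applied to f^-a z gives
   deg (f^-a z) <= 2 (1 + 2^(a+b)) - 3 <= 1. A linear map commuting with A sigma is
   monomial and then trivial, by algebraic independence of the entries of A. *)

Set Implicit Arguments.
Unset Strict Implicit.
Unset Printing Implicit Defensive.

Import Order.TTheory GRing.Theory Num.Theory.

Local Open Scope ring_scope.

(** * Factorial rings *)

Section Divisibility.
Variable R : idomainType.
Implicit Types (a b c m p : R) (s : seq R).

(** The geometry is encoded by congruences: a curve [p = 0] is contracted to a point [v] to order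
    [s] when the triple is proportional to [v] modulo [p ^+ s]. Multiplicities of dropped factors
    are thus carried by prime powers, without blow-ups, and unique factorization assembles them into
    one divisibility. The bound 3 (deg z - 1) is the degree of the Jacobian determinant of three
    forms of degree deg z; characteristic zero makes this determinant nonzero. A form [C] with C(f)
    = k C^2 is constant for two reasons. If its curve passed through a point to which f contracts a
    line, it would contain that line and all its preimages under powers of f, hence infinitely many
    components. Since it avoids these points, it contains none of the three lines contracted by
    f^-1, and comparing multiplicities along them makes [C] a square, whose root satisfies the same
    equation with k or -k. *)

Definition divides a b : Prop := exists c, b = a * c.

Definition prime_elt p : Prop :=
  [/\ p != 0, p \isn't a GRing.unit
    & forall a b, divides p (a * b) -> divides p a \/ divides p b].

Definition prime_factorization a s : Prop :=
  (forall p, p \in s -> prime_elt p) /\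
  exists2 u, u \is a GRing.unit & a = u * \prod_(p <- s) p.

Lemma divides_refl a : divides a a.
Proof. by exists 1; rewrite mulr1. Qed.

Lemma divides_trans b a c : divides a b -> divides b c -> divides a c.
Proof. by move=> [x ->] [y ->]; exists (x * y); rewrite mulrA. Qed.

Lemma divides_mulr a b c : divides a b -> divides a (b * c).
Proof. by move=> [x ->]; exists (x * c); rewrite mulrA. Qed.

Lemma divides_mull a b c : divides a b -> divides a (c * b).
Proof. by rewrite mulrC; apply: divides_mulr. Qed.

Lemma divides0 a : divides a 0.
Proof. by exists 0; rewrite mulr0. Qed.

Lemma dividesD a b c : divides a b -> divides a c -> divides a (b + c).
Proof. by move=> [x ->] [y ->]; exists (x + y); rewrite mulrDr. Qed.

Lemma dividesN a b : divides a b -> divides a (- b).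
Proof. by move=> [x ->]; exists (- x); rewrite mulrN. Qed.

Lemma dividesB a b c : divides a b -> divides a c -> divides a (b - c).
Proof. by move=> ab ac; apply/dividesD/dividesN. Qed.

Lemma divides_exp m a n : (0 < n)%N -> divides m (m ^+ n).
Proof. by case: n => // n _; exists (m ^+ n); rewrite exprS. Qed.

Lemma divides_unitl u a b : u \is a GRing.unit -> divides a (u * b) -> divides a b.
Proof. by move=> uu [c E]; exists (c * u^-1); rewrite mulrA -E mulrC mulKr. Qed.

Lemma prime_unit p : prime_elt p -> ~ (exists2 u, u \is a GRing.unit & divides p u).
Proof.
case=> _ /negP pU _ [u uu [c E]]; apply: pU.
by move: uu; rewrite E unitrM => /andP[].
Qed.

Lemma prime_exp p a n : prime_elt p -> divides p (a ^+ n) -> divides p a.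
Proof.
move=> pp; elim: n => [|n IHn].
  by rewrite expr0 => p1; case: (prime_unit pp); exists 1; rewrite ?unitr1.
by rewrite exprS; case: pp => _ _ H /H[].
Qed.

Lemma prime_prod p (I : Type) (r : seq I) (F : I -> R) : prime_elt p ->
  divides p (\prod_(i <- r) F i) -> exists i, divides p (F i).
Proof.
move=> pp; elim: r => [|i r IHr].
  by rewrite big_nil => p1; case: (prime_unit pp); exists 1; rewrite ?unitr1.
by rewrite big_cons; case: pp => _ _ H /H[]; [exists i|].
Qed.

Lemma prime_prod_mem p (I : eqType) (r : seq I) (F : I -> R) : prime_elt p ->
  divides p (\prod_(i <- r) F i) -> exists2 i, i \in r & divides p (F i).
Proof.
move=> pp; elim: r => [|i r IHr].
  by rewrite big_nil => p1; case: (prime_unit pp); exists 1; rewrite ?unitr1.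
rewrite big_cons; case: pp => _ _ H /H[]; first by exists i; rewrite ?mem_head.
by move=> /IHr[j jr pj]; exists j; rewrite // inE jr orbT.
Qed.

Lemma prime_cancel p a b n : prime_elt p -> ~ divides p a ->
  divides (p ^+ n) (a * b) -> divides (p ^+ n) b.
Proof.
move=> pp pa; elim: n b => [|n IHn] b.
  by move=> _; exists b; rewrite expr0 mul1r.
move=> [c E].
have [//|[b' Eb]] : divides p a \/ divides p b.
  by case: pp => _ _; apply; exists (p ^+ n * c); rewrite E exprS mulrA.
have [|d Ed] := IHn b'; last by exists d; rewrite Eb Ed exprS mulrA.
exists c; case: pp => p0 _ _; apply: (mulfI p0).
by rewrite mulrCA -Eb E exprS mulrA.
Qed.

Lemma prime_cancelr p a b n : prime_elt p -> ~ divides p b ->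
  divides (p ^+ n) (a * b) -> divides (p ^+ n) a.
Proof. by rewrite mulrC; apply: prime_cancel. Qed.

Definition factorial_ring : Prop := forall a, a != 0 -> exists s, prime_factorization a s.

Lemma factorization_divides p a s : prime_elt p -> prime_factorization a s ->
  divides p a -> exists2 q, q \in s & exists2 u, u \is a GRing.unit & q = u * p.
Proof.
move=> pp [sp [u uu ->]] /(divides_unitl uu) /(prime_prod_mem pp)[q qs [c Eq]].
exists q => //; exists c; last by rewrite mulrC.
have [q0 qU qP] := sp _ qs.
have [[x Ex]|[x Ex]] : divides q p \/ divides q c.
- by apply: qP; exists 1; rewrite mulr1 Eq.
- have /(mulfI q0) : q * (x * c) = q * 1 by rewrite mulr1 mulrA -Ex -Eq.
  by move=> xc; apply/unitrP; exists x; rewrite [c * x]mulrC xc.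
have /(mulfI q0) : q * (x * p) = q * 1 by rewrite mulr1 mulrA -Ex mulrC -Eq.
by move=> xp; case: pp => _ /negP[]; apply/unitrP; exists x; rewrite [p * x]mulrC xp.
Qed.

Lemma factorization_div p a b s : prime_elt p -> prime_factorization a s ->
  a = p * b -> exists2 s', prime_factorization b s' & size s = (size s').+1.
Proof.
move=> pp fa Ea.
have [q qs [u uu Eq]] : exists2 q, q \in s & exists2 u, u \is a GRing.unit & q = u * p.
  by apply: factorization_divides pp fa _; exists b.
have p0 : p != 0 by case: pp.
case: fa => sp [v vu Ev]; exists (rem q s); last first.
  by rewrite size_rem //; case: (s) qs.
split; first by move=> r /mem_rem; apply: sp.
exists (v * u); first by rewrite unitrM vu.
apply: (mulfI p0); rewrite -Ea Ev (big_rem _ qs) /= Eq.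
by rewrite !mulrA; congr (_ * _); rewrite mulrC !mulrA.
Qed.

Hypothesis fR : factorial_ring.

(** Induction on the number of prime factors of [a]. This is the passage from local statements, one
    prime at a time, to the divisibility of a Jacobian by a whole product of dropped factors. *)
Lemma divides_primepow a b : a != 0 ->
  (forall p n, prime_elt p -> divides (p ^+ n) a -> divides (p ^+ n) b) ->
  divides a b.
Proof.
move=> a0 H; have [s fa] := fR a0.
elim: {s}(size s) {-2}s (erefl (size s)) a b a0 H fa => [|n IHn] s Es a b a0 H fa.
  case: fa => _ [u uu]; rewrite (size0nil Es) big_nil mulr1 => ->.
  by exists (u^-1 * b); rewrite mulVKr.
case: s Es fa => // q s [Es] fa.
have qp : prime_elt q by case: fa => sp _; apply/sp/mem_head.
have [a' Ea] : divides q a.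
  by case: fa => _ [u _ ->]; exists (u * \prod_(p <- s) p); rewrite big_cons mulrCA.
have [b' Eb] : divides q b.
  by rewrite -[q]expr1; apply: H => //; exists a'; rewrite expr1.
have [s' fa' Es'] := factorization_div qp fa Ea.
have q0 : q != 0 by case: qp.
have a'0 : a' != 0 by apply: contraNneq a0 => E; rewrite Ea E mulr0.
suff [x Ex] : divides a' b' by exists x; rewrite Eb Ea Ex mulrA.
apply: (IHn s') => //; first by case: Es'; rewrite Es.
move=> p m pp [c Ec].
(* If [p] divides [q] the two are associates, and the hypothesis is used at exponent [m.+1], one
   power being spent on [q]; otherwise [q] cancels. *)
have [[d Ed]|npq] := pselect (divides p q).
  have [u uu Eq] : exists2 u, u \is a GRing.unit & q = u * p.
    exists d; last by rewrite mulrC.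
    have [[x Ex]|[x Ex]] : divides q p \/ divides q d.
    - by case: qp => _ _; apply; exists 1; rewrite mulr1 Ed.
    - apply/unitrP; exists x; rewrite [d * x]mulrC.
      suff -> : x * d = 1 by [].
      by apply: (mulfI q0); rewrite mulr1 mulrA -Ex -Ed.
    have p0 : p != 0 by case: pp.
    have : q * (x * p) = q * 1 by rewrite mulr1 mulrA -Ex mulrC -Ed.
    move=> /(mulfI q0) xp; case: pp => _ /negP[]; apply/unitrP.
    by exists x; rewrite [p * x]mulrC xp.
  have [e Ee] : divides (p ^+ m.+1) b.
    by apply: H => //; exists (u * c); rewrite Ea Ec Eq exprS; ring.
  exists (u^-1 * e); apply: (mulfI q0); rewrite -Eb Ee Eq exprS.
  by ring: (mulrV uu).
have : divides (p ^+ m) b by apply: H => //; rewrite Ea Ec; exists (q * c); rewrite mulrCA.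
by rewrite Eb => /(prime_cancel pp npq).
Qed.

End Divisibility.

(** * Gauss's lemma: polynomials over a factorial ring *)

Section Gauss.
Variable R : idomainType.
Hypothesis fR : factorial_ring R.
Implicit Types (c p : R) (f g h : {poly R}).

Lemma divides_polyC c f : divides c%:P f <-> forall i, divides c f`_i.
Proof.
split=> [[g ->] i|H]; first by exists g`_i; rewrite coefCM.
have [g Hg] := choice H.
exists (\poly_(i < size f) g i); apply/polyP => i.
rewrite coefCM coef_poly; case: ltnP => [_|fi]; first exact: Hg.
by rewrite mulr0 nth_default.
Qed.

Lemma min_coef_nondiv p f : ~ divides p%:P f ->
  exists i, ~ divides p f`_i /\ forall k, (k < i)%N -> divides p f`_k.
Proof.
move=> /divides_polyC/existsNP[i0 Hi0].
have ex : exists i, ~~ `[< divides p f`_i >] by exists i0; apply/negP => /asboolP.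
exists (ex_minn ex); case: ex_minnP => i /negP pi imin.
split=> [/asboolP//|k ki]; apply/asboolP; apply: contraLR ki.
by move=> /imin; rewrite -leqNgt.
Qed.

(** Take the least indices i and j of coefficients of [f] and [g] not divisible by [p]. In the
    coefficient of index i + j of the product, every term other than f_i g_j is divisible by [p]. *)
Lemma prime_polyC p : prime_elt p -> prime_elt p%:P.
Proof.
move=> pp; have [p0 pU pP] := pp; split; first by rewrite polyC_eq0.
  by apply: contra pU; rewrite poly_unitE coefC eqxx => /andP[].
move=> f g pfg; apply: contrapT => /not_orP[/min_coef_nondiv[i [pi Hi]]].
move=> /min_coef_nondiv[j [pj Hj]].
suff : divides p (f`_i * g`_j) by case/pP.
have ij : (i < (i + j).+1)%N by rewrite ltnS leq_addr.
have -> : f`_i * g`_j = (f * g)`_(i + j)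
   - \sum_(k < (i + j).+1 | k != Ordinal ij) f`_k * g`_(i + j - k).
  by rewrite coefM (bigD1 (Ordinal ij)) //= addKn addrK.
apply: dividesB; first by move/divides_polyC: pfg; apply.
apply: (big_ind (divides p)); [exact: divides0|exact: dividesD|].
move=> k ki; case: (ltngtP k i) => [/Hi|ik|E].
- exact: divides_mulr.
- by apply/divides_mull/Hj; rewrite ltn_subLR ?ltn_add2r // -ltnS.
by case/eqP: ki; apply: val_inj.
Qed.

Definition primitive f : Prop := forall p, prime_elt p -> ~ divides p%:P f.

Lemma primitive_cancel f g c : primitive f -> c != 0 ->
  divides f (c%:P * g) -> divides f g.
Proof.
move=> fp c0; have [s [sp [u uu Ec]]] := fR c0; move: Ec c0 => -> _.
rewrite polyCM -mulrA => /divides_unitl[]; first by rewrite rmorph_unit.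
elim: s sp => [_|p s IHs sp] h.
  by rewrite big_nil mul1r => ->; exists h.
have pp : prime_elt p by apply/sp/mem_head.
rewrite big_cons polyCM -mulrA => E.
have [_ _ pP] := prime_polyC pp.
have [/(fp _ pp)//|[h' Eh]] : divides p%:P f \/ divides p%:P h.
  by apply: pP; rewrite -E; exists ((\prod_(q <- s) q)%:P * g).
apply: (IHs _ h') => [q qs|]; first by apply: sp; rewrite inE qs orbT.
have p0 : p%:P != 0 by rewrite polyC_eq0; case: pp.
by apply: (mulfI p0); rewrite E Eh mulrCA.
Qed.

Lemma primitive_part f : f != 0 ->
  exists s g, [/\ forall p, p \in s -> prime_elt p, primitive g
                & f = (\prod_(p <- s) p)%:P * g].
Proof.
move=> f0; have [t ft] : exists t, prime_factorization (lead_coef f) t.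
  by apply: fR; rewrite lead_coef_eq0.
elim: {t}(size t) {-2}t (erefl (size t)) f f0 ft => [|n IHn] t Et f f0 ft.
  exists [::], f; split=> //; last by rewrite big_nil mul1r.
  move=> p pp /divides_polyC /(_ (size f).-1).
  by move=> /(factorization_divides pp ft)[q]; rewrite (size0nil Et).
have [fp|/existsNP[p /not_implyP[pp /contrapT[g Eg]]]] := pselect (primitive f).
  by exists [::], f; split=> //; rewrite big_nil mul1r.
have g0 : g != 0 by apply: contraNneq f0 => g0; rewrite Eg g0 mulr0.
have El : lead_coef f = p * lead_coef g by rewrite Eg lead_coefM lead_coefC.
have [t' ft' Et'] := factorization_div pp ft El.
have [s [h [sp hp Eh]]] := IHn t' ltac:(lia) g g0 ft'.
exists (p :: s), h; split=> //; last by rewrite big_cons polyCM -mulrA -Eh.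
by move=> q; rewrite inE => /predU1P[->//|/sp].
Qed.

Lemma primitive_const f : primitive f -> (size f <= 1)%N -> f != 0 ->
  f \is a GRing.unit.
Proof.
move=> fp /size1_polyC Ef; rewrite Ef polyC_eq0 => f0.
have [[|p s] [sp [u uu Eu]]] := fR f0.
  by rewrite Eu big_nil mulr1 rmorph_unit.
have /fp[] := sp _ (mem_head p s).
by rewrite Ef Eu big_cons; exists (u * \prod_(q <- s) q)%:P; rewrite -polyCM mulrCA.
Qed.

(** The primitive part [r1] of a minimal element of the ideal (f, a) divides both [f] and [a]. By
    irreducibility, either [r1] is a unit, so that the ideal contains a nonzero constant and [f]
    divides its product with [b]; or [f] is an associate of [r1] and divides [a]. *)
Lemma primitive_irreducible_prime f : primitive f -> (1 < size f)%N ->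
  (forall g h, f = g * h -> g \is a GRing.unit \/ h \is a GRing.unit) ->
  prime_elt f.
Proof.
move=> fp sf irr; have f0 : f != 0 by rewrite -size_poly_gt0 ltnW.
split=> //; first by rewrite poly_unitE gtn_eqF.
move=> a b fab; pose I r := exists u v, r = u * f + v * a.
(* A nonzero element of minimal size in the ideal (f, a) pseudo-divides both. *)
have exI : exists n, `[< exists2 r, r != 0 & I r /\ size r = n >].
  exists (size f); apply/asboolP; exists f => //; split=> //.
  by exists 1, 0; rewrite mul1r mul0r addr0.
case: (ex_minnP exI) => n /asboolP[r r0 [Ir sr]] nmin.
have pdiv g : I g -> exists2 c, c != 0 & divides r (c%:P * g).
  move=> [u' [v' Eg]]; have := Pdiv.Idomain.divp_eq g r.
  set c := lead_coef r ^+ _ => E.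
  exists c; first by rewrite expf_neq0 // lead_coef_eq0.
  exists (g %/ r); rewrite mul_polyC E.
  have [->|m0] := eqVneq (g %% r) 0; first by rewrite addr0 mulrC.
  have := ltn_modp g r; rewrite r0 ltnNge sr nmin //.
  apply/asboolP; exists (g %% r) => //; split=> //.
  case: Ir => u [v Er]; exists (c *: u' - g %/ r * u), (c *: v' - g %/ r * v).
  have -> : g %% r = c *: g - g %/ r * r by rewrite E addrC addKr.
  by rewrite {1}Eg {2}Er -!mul_polyC; ring.
have [s [r1 [_ pr1 Er1]]] := primitive_part r0.
have r1g g : I g -> divides r1 g.
  move=> /pdiv[c c0 [q Eq]]; apply: (primitive_cancel pr1 c0).
  by rewrite Eq Er1; exists ((\prod_(p <- s) p)%:P * q); ring.
have [g Eg] : divides r1 f by apply: r1g; exists 1, 0; rewrite mul1r mul0r addr0.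
have r1a : divides r1 a by apply: r1g; exists 0, 1; rewrite mul1r mul0r add0r.
have [r1U|gU] := irr _ _ Eg; [right|left].
  case: Ir => u [v Er].
  have Ec : r = (\prod_(p <- s) p * r1`_0)%:P.
    rewrite Er1 polyCM; congr (_ * _); apply: size1_polyC.
    by move: r1U; rewrite poly_unitE => /andP[/eqP->].
  apply: (@primitive_cancel f b (\prod_(p <- s) p * r1`_0)) => //.
    by rewrite -polyC_eq0 -Ec.
  rewrite -Ec Er mulrDl; apply: dividesD.
    by exists (u * b); ring.
  by rewrite -mulrA; apply: divides_mull.
apply: divides_trans r1a; exists g^-1.
by rewrite Eg mulrK.
Qed.

Lemma factorization_cat (S : idomainType) (a b : S) s t :
  prime_factorization a s -> prime_factorization b t ->
  prime_factorization (a * b) (s ++ t).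
Proof.
move=> [sp [u uu ->]] [tp [v vu ->]]; split.
  by move=> p; rewrite mem_cat => /orP[/sp|/tp].
by exists (u * v); rewrite ?unitrM ?uu // big_cat mulrACA.
Qed.

Lemma primitive_factorization f : primitive f -> f != 0 ->
  exists s, prime_factorization f s.
Proof.
elim: {f}(size f).+1 {-2}f (ltnSn (size f)) => // n IHn f fn fp f0.
have fU : f \is a GRing.unit -> exists s, prime_factorization f s.
  by move=> fU; exists [::]; split=> //; exists f; rewrite // big_nil mulr1.
have [/(primitive_const fp)/(_ f0)/fU//|sf] := leqP (size f) 1.
have [irr|] := pselect (forall g h, f = g * h -> g \is a GRing.unit \/ h \is a GRing.unit).
  exists [:: f]; split; last by exists 1; rewrite ?unitr1 // big_seq1 mul1r.
  by move=> p; rewrite inE => /eqP->; apply: primitive_irreducible_prime.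
move=> /existsNP[g /existsNP[h /not_implyP[E /not_orP[gU hU]]]].
have [g0 h0] : g != 0 /\ h != 0 by apply/andP; rewrite -negb_or -mulf_eq0 -E.
have gp : primitive g by move=> p pp pg; apply: (fp p pp); rewrite E; apply: divides_mulr.
have hp : primitive h by move=> p pp ph; apply: (fp p pp); rewrite E; apply: divides_mull.
have sg : (1 < size g)%N by rewrite ltnNge; apply/negP => /(primitive_const gp)/(_ g0).
have sh : (1 < size h)%N by rewrite ltnNge; apply/negP => /(primitive_const hp)/(_ h0).
have := size_mul g0 h0; rewrite -E => Es.
have [|s fs] := IHn g _ gp g0; first by lia.
have [|t ft] := IHn h _ hp h0; first by lia.
by exists (s ++ t); rewrite E; apply: factorization_cat.
Qed.

Theorem factorial_poly : factorial_ring {poly R}.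
Proof.
move=> f f0; have [s [g [sp gp E]]] := primitive_part f0.
have g0 : g != 0 by apply: contraNneq f0 => g0; rewrite E g0 mulr0.
have [t ft] := primitive_factorization gp g0.
exists ([seq p%:P | p <- s] ++ t); rewrite E; apply: factorization_cat => //; split.
  by move=> _ /mapP[p ps ->]; apply/prime_polyC/sp.
by exists 1; rewrite ?unitr1 // mul1r big_map rmorph_prod.
Qed.

End Gauss.

Section FactorialIso.
Variables (R S : idomainType) (f : {rmorphism R -> S}) (g : S -> R).
Hypotheses (fK : cancel f g) (gK : cancel g f).

Lemma prime_iso p : prime_elt p -> prime_elt (f p).
Proof.
move=> [p0 pU pP]; split.
- by apply: contraNneq p0 => fp0; rewrite -[p]fK fp0 -(rmorph0 f) fK.
- apply: contra pU => /unitrP[x [E _]]; apply/unitrP; exists (g x).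
  have gp : g x * p = 1 by apply: (can_inj fK); rewrite rmorphM gK E rmorph1.
  by split; [|rewrite mulrC]; exact: gp.
move=> a b [c E]; have : divides p (g a * g b).
  by exists (g c); apply: (can_inj fK); rewrite !rmorphM !gK.
by case/pP=> -[x Ex]; [left|right]; exists (f x); rewrite -rmorphM -Ex gK.
Qed.

Lemma factorial_iso : factorial_ring R -> factorial_ring S.
Proof.
move=> fR a a0; have [|s [sp [u uu E]]] := fR (g a).
  by apply: contraNneq a0 => ga0; rewrite -[a]gK ga0 rmorph0.
exists (map f s); split; first by move=> _ /mapP[p ps ->]; apply/prime_iso/sp.
by exists (f u); rewrite ?rmorph_unit // big_map -rmorph_prod -rmorphM -E gK.
Qed.

End FactorialIso.

(** * Unique factorization in several variables, singling out the last variable *)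

Section FactorialMpoly.
Variable K : fieldType.

Lemma mpolyC_unit n (c : K) : c != 0 -> c%:MP_[n] \is a GRing.unit.
Proof. by move=> c0; rewrite rmorph_unit ?unitfE. Qed.

Lemma mpoly_rmorph_eq n (S : comNzRingType) (f g : {rmorphism {mpoly K[n]} -> S}) :
  (forall c, f c%:MP = g c%:MP) -> (forall i, f 'X_i = g 'X_i) -> f =1 g.
Proof.
move=> HC HX p; rewrite [p]mpolyE !rmorph_sum; apply: eq_bigr => m _ /=.
rewrite -mul_mpolyC !rmorphM /= HC mpolyXE_id !rmorph_prod /=.
by congr (_ * _); apply: eq_bigr => i _; rewrite !rmorphXn /= HX.
Qed.

Section Step.
Variable n : nat.

Let widen (j : 'I_n) : 'I_n.+1 := widen_ord (leqnSn n) j.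

Let ord_maxVwiden (i : 'I_n.+1) : i = ord_max \/ exists j, i = widen j.
Proof.
have [ni|] := ltnP i n; first by right; exists (Ordinal ni); apply: val_inj.
by move=> ni; left; apply: val_inj => /=; have := ltn_ord i; lia.
Qed.

Let muni_max : muni 'X_ord_max = 'X :> {poly {mpoly K[n]}}.
Proof.
rewrite muniE msuppX big_seq1 mcoeffX eqxx scale1r mnmE eqxx expr1.
rewrite (_ : [multinom _ | _ < n] = 0%MM) ?mpolyX0 ?scale1r //.
by apply/mnmP => j; rewrite !mnmE -val_eqE /= gtn_eqF.
Qed.

Let muni_widen (j : 'I_n) : muni 'X_(widen j) = ('X_j)%:P :> {poly {mpoly K[n]}}.
Proof.
rewrite muniE msuppX big_seq1 mcoeffX eqxx scale1r mnmE -val_eqE /= ltn_eqF //.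
rewrite expr0 alg_polyC; congr ('X_[_])%:P.
by apply/mnmP => k; rewrite !mnmE.
Qed.

Let comm_max : commr_rmorph (@mwiden n K) 'X_ord_max.
Proof. by move=> x; apply: mulrC. Qed.

Let back : {poly {mpoly K[n]}} -> {mpoly K[n.+1]} := horner_morph comm_max.

HB.instance Definition _ := GRing.RMorphism.on back.

Let mwidenXU (j : 'I_n) : mwiden 'X_j = 'X_(widen j) :> {mpoly K[n.+1]}.
Proof. by rewrite mwidenX mnmwiden1. Qed.

Let muniK : cancel (@muni n K) back.
Proof.
move=> p; apply: (mpoly_rmorph_eq (f := back \o @muni n K) (g := idfun)) => [c|i] /=.
  by rewrite muniC /back horner_morphC /= mwidenC.
have [->|[j ->]] := ord_maxVwiden i; first by rewrite muni_max /back horner_morphX.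
by rewrite muni_widen /back horner_morphC /= mwidenXU.
Qed.

Let muni_mwiden (p : {mpoly K[n]}) : muni (mwiden p) = p%:P.
Proof.
apply: (mpoly_rmorph_eq (f := @muni n K \o @mwiden n K) (g := polyC)) => [c|i] /=.
  by rewrite mwidenC muniC.
by rewrite mwidenXU muni_widen.
Qed.

Let backK : cancel back (@muni n K).
Proof.
elim/poly_ind => [|p c IHp]; first by rewrite !rmorph0.
rewrite !(rmorphD, rmorphM) /= IHp; congr (_ * _ + _).
  by rewrite /back horner_morphX muni_max.
by rewrite /back horner_morphC /= muni_mwiden.
Qed.

Lemma factorial_mpolyS : factorial_ring {mpoly K[n]} -> factorial_ring {mpoly K[n.+1]}.
Proof. by move=> /factorial_poly; apply: factorial_iso backK muniK. Qed.

End Step.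

Theorem factorial_mpoly n : factorial_ring {mpoly K[n]}.
Proof.
elim: n => [|n]; last exact: factorial_mpolyS.
move=> p; rewrite (nvar0_mpolyC p) mpolyC_eq0 => p0.
exists [::]; split=> //; exists (p@_0%MM)%:MP; last by rewrite big_nil mulr1.
exact: mpolyC_unit.
Qed.

End FactorialMpoly.

(** * Homogeneous triples *)

Section Homogeneous.
Variables (K : fieldType) (n : nat).
Implicit Types (p q : {mpoly K[n]}) (d e : nat).

Lemma mlastcM p q : p != 0 -> q != 0 ->
  (p * q)@_(mlast p + mlast q) = p@_(mlast p) * q@_(mlast q).
Proof.
move=> p0 q0; rewrite mpolyME (bigD1_seq (mlast p, mlast q)) /=; first last.
+ by rewrite allpairs_uniq => // -[? ?] [].
+ by rewrite allpairs_f// !mlast_supp.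
rewrite mcoeffD mcoeffZ mcoeffX eqxx mulr1.
rewrite big_seq_cond raddf_sum /= big1 ?addr0 //.
case=> m1 m2 /andP[/allpairsP[[k1 k2] /= [m1p m2q [-> ->]]] ne]; rewrite mcoeffZ mcoeffX.
move/mlast_lemc: m1p; move/mlast_lemc: m2q.
rewrite le_eqVlt => /predU1P[m2E|]; last first.
  by move=> lt /lemc_lt_add /(_ lt) /gt_eqF ->; rewrite mulr0.
move: ne; rewrite m2E xpair_eqE eqxx andbT.
rewrite le_eqVlt eq_sym => /negbTE -> /=; rewrite eqm_add2r.
by move/gt_eqF=> ->; rewrite mulr0.
Qed.

(** In the product, the largest monomials of the factors and also the smallest ones have degrees
    adding up to [d]. The order being graded, the smallest has at most the degree of the largest in
    each factor, so equality holds in both. *)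
Lemma homog_factor p q d : p * q != 0 -> p * q \is d.-homog ->
  exists2 e, p \is e.-homog & (e <= d)%N.
Proof.
rewrite mulf_eq0 negb_or => /andP[p0 q0] /dhomogP pqd.
have lastd : mdeg (mlast p + mlast q) = d.
  by apply: pqd; rewrite mcoeff_msupp mlastcM // mulf_neq0 // -mcoeff_msupp mlast_supp.
have leadd : mdeg (mlead p + mlead q) = d.
  by apply: pqd; rewrite mcoeff_msupp mleadcM // mulf_neq0 // mleadc_eq0.
have lelast (r : {mpoly K[n]}) : r != 0 -> (mdeg (mlast r) <= mdeg (mlead r))%N.
  by move=> r0; apply/lemc_mdeg/mlast_lemc/mlead_supp.
have := lelast p p0; have := lelast q q0; rewrite !mdegD in lastd leadd => lq lp.
exists (mdeg (mlead p)); last by rewrite -leadd leq_addr.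
apply/dhomogP => m mp; have := lemc_mdeg (mlast_lemc mp).
have := lemc_mdeg (msupp_le_mlead mp); rewrite /=; lia.
Qed.

Lemma homog_cofactor p q d e : p * q != 0 ->
  p * q \is d.-homog -> q \is e.-homog ->
  (e <= d)%N /\ p \is (d - e)%N.-homog.
Proof.
move=> pq0 pqd qe; have [c pc cd] := homog_factor pq0 pqd.
have := dhomog_uniq pq0 pqd (dhomogM pc qe) => E.
by split; [rewrite E leq_addl|rewrite E addnK].
Qed.

Lemma mpoly_unitP p : reflect (exists2 c, c != 0 & p = c%:MP) (p \is a GRing.unit).
Proof.
apply: (iffP idP) => [|[c c0 ->]]; last exact: mpolyC_unit.
move=> /andP[/eqP E u]; exists p@_0%MM => //; by rewrite -unitfE.
Qed.

Lemma homog0_const p : p \is 0.-homog -> p = (p@_0%MM)%:MP.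
Proof.
move=> /dhomogP ph; apply/mpolyP => m; rewrite mcoeffC.
have [->|m0] := eqVneq m 0%MM; first by rewrite mulr1.
rewrite mulr0; apply/eqP; rewrite mcoeff_eq0; apply: contra m0 => /ph /eqP.
by rewrite mdeg_eq0.
Qed.

Lemma homog_unit p d : p \is a GRing.unit -> p \is d.-homog -> d = 0%N.
Proof.
move=> /mpoly_unitP[c c0 ->] cd.
have := cd; rewrite -[c%:MP]mulr1 mul_mpolyC => cd'.
apply: dhomog_uniq cd' _; first by rewrite scaler_eq0 oner_eq0 orbF.
exact/dhomogZ/dhomog1.
Qed.

Lemma homog0_unit p : p != 0 -> p \is 0.-homog -> p \is a GRing.unit.
Proof.
move=> p0 /homog0_const E; apply/mpoly_unitP; exists p@_0%MM => //.
by apply: contraNneq p0 => c0; rewrite E c0 mpolyC0.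
Qed.

Lemma prime_homog_gt0 p d : prime_elt p -> p \is d.-homog -> (0 < d)%N.
Proof. by move=> [p0 /negP pU _]; case: d => // /(homog0_unit p0). Qed.

Lemma exists_prime_divisor p : p != 0 -> p \isn't a GRing.unit ->
  exists2 r, prime_elt r & divides r p.
Proof.
move=> p0 pU; have [[|r s] [sp [u uu E]]] := factorial_mpoly p0.
  by rewrite E big_nil mulr1 uu in pU.
exists r; first exact/sp/mem_head.
by rewrite E big_cons; exists (u * \prod_(q <- s) q); rewrite mulrCA.
Qed.

End Homogeneous.

Section Triples.
Variable K : fieldType.
Implicit Types (f g T H : triple K) (C : {mpoly K[3]}).

Definition hdeg T d : Prop :=
  (exists i, tnth T i != 0) /\ forall i, tnth T i \is d.-homog.

Definition scale_triple C T : triple K := [tuple C * tnth T i | i < 3].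

Definition reduced T : Prop :=
  is_ratmap T /\ forall p, prime_elt p -> ~ forall i, divides p (tnth T i).

Lemma ratmap_hdeg T : is_ratmap T -> exists d, hdeg T d.
Proof. by case=> T0 [d Td]; exists d. Qed.

Lemma hdeg_ratmap T d : hdeg T d -> is_ratmap T.
Proof. by case=> T0 Td; split=> //; exists d. Qed.

Lemma hdeg_uniq T d e : hdeg T d -> hdeg T e -> d = e.
Proof. by case=> [[i Ti] Td] [_ Te]; apply: dhomog_uniq Ti (Td i) (Te i). Qed.

Lemma scale_triple1 T : scale_triple 1 T = T.
Proof. by apply: eq_from_tnth => i; rewrite tnth_mktuple mul1r. Qed.

Lemma scale_tripleA C D T : scale_triple C (scale_triple D T) = scale_triple (C * D) T.
Proof. by apply: eq_from_tnth => i; rewrite !tnth_mktuple mulrA. Qed.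

Lemma scale_tripleI C D T : is_ratmap T -> scale_triple C T = scale_triple D T -> C = D.
Proof.
move=> [[i Ti] _] /(congr1 (fun t => tnth t i)); rewrite !tnth_mktuple.
exact: mulIf.
Qed.

Lemma hdeg_scale C T d e : C != 0 -> C \is e.-homog -> hdeg T d ->
  hdeg (scale_triple C T) (e + d).
Proof.
move=> C0 Ce [[i Ti] Td]; split; first by exists i; rewrite tnth_mktuple mulf_neq0.
by move=> j; rewrite tnth_mktuple dhomogM.
Qed.

Lemma hdeg_unscale C H d : hdeg (scale_triple C H) d ->
  C != 0 /\ exists c e, [/\ C \is c.-homog, hdeg H e & d = (c + e)%N].
Proof.
move=> [[i Ti] Td]; rewrite tnth_mktuple in Ti.
have /andP[C0 Hi] : (C != 0) && (tnth H i != 0) by rewrite -negb_or -mulf_eq0.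
have hom j : C * tnth H j \is d.-homog by have := Td j; rewrite tnth_mktuple.
have [c Cc cd] := homog_factor Ti (hom i).
split=> //; exists c, (d - c)%N; split=> //; last by rewrite subnKC.
split; first by exists i.
move=> j; have [->|Hj] := eqVneq (tnth H j) 0; first exact: dhomog0.
have hj : tnth H j * C \is d.-homog by rewrite mulrC.
by have [] := homog_cofactor (mulf_neq0 Hj C0) hj Cc.
Qed.

Lemma reduce_ex T : is_ratmap T ->
  exists C H, [/\ C != 0, reduced H & T = scale_triple C H].
Proof.
move=> /ratmap_hdeg[d]; elim/ltn_ind: d T => d IHd T Td.
have [Tr|] := pselect (reduced T).
  by exists 1, T; rewrite oner_neq0 scale_triple1.
move=> /not_andP[[]|]; first exact: hdeg_ratmap Td.
move=> /existsNP[p /not_implyP[pp /contrapT/choice[h Eh]]].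
pose H : triple K := [tuple h i | i < 3].
have E : T = scale_triple p H.
  by apply: eq_from_tnth => i; rewrite !tnth_mktuple.
move: (Td); rewrite E => /hdeg_unscale[_ [c [e [pc He dE]]]].
have c0 := prime_homog_gt0 pp pc.
have [|C [H' [C0 H'r EH]]] := IHd e _ H He; first by lia.
exists (p * C), H'; split=> //; last by rewrite EH scale_tripleA.
by rewrite mulf_neq0 //; case: pp.
Qed.

(** At each prime some coordinate of [H] is not divisible by it; the proportionality relation with
    that coordinate passes every prime power dividing H_i on to T_i. Hence H_i divides T_i. *)
Lemma reduced_factor T H : is_ratmap T -> reduced H -> same_ratmap T H ->
  exists2 C : {mpoly K[3]}, C != 0 & T = scale_triple C H.
Proof.
move=> [[k Tk] _] [[[i Hi] _] Hr] /same_ratmapP TH.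
have [C EC] : divides (tnth H i) (tnth T i).
  apply: (divides_primepow (@factorial_mpoly K 3) Hi) => p n pp pn.
  have /existsNP[j pj] := Hr p pp.
  have : divides (p ^+ n) (tnth T i * tnth H j) by rewrite TH; apply: divides_mull.
  exact: prime_cancelr.
have E : T = scale_triple C H.
  apply: eq_from_tnth => j; rewrite tnth_mktuple; apply: (mulIf Hi).
  by rewrite TH EC; ring.
exists C => //; apply: contraNneq Tk => C0.
by rewrite E tnth_mktuple C0 mul0r.
Qed.

Lemma same_scale_triple C T : same_ratmap (scale_triple C T) T.
Proof. by apply/same_ratmapP => i j; rewrite !tnth_mktuple; ring. Qed.

Lemma tnth_comp f g i : tnth (triple_comp f g) i = tnth f i \mPo g.
Proof. by rewrite tnth_mktuple. Qed.

Lemma comp_scale_triple f C T d : (forall i, tnth f i \is d.-homog) ->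
  triple_comp f (scale_triple C T) = scale_triple (C ^+ d) (triple_comp f T).
Proof.
by move=> fd; apply: eq_from_tnth => i; rewrite !tnth_mktuple (comp_scale _ _ (fd i)).
Qed.

Lemma scale_triple_comp C T g :
  triple_comp (scale_triple C T) g = scale_triple (C \mPo g) (triple_comp T g).
Proof. by apply: eq_from_tnth => i; rewrite !tnth_mktuple rmorphM. Qed.

Lemma birational_unscale C T H : C != 0 -> T = scale_triple C H ->
  birational T -> birational H.
Proof.
move=> C0 E [rT [g [rg rTg Tg rgT gT]]].
have [d Td] := ratmap_hdeg rT.
have rH : is_ratmap H.
  by move: Td; rewrite E => /hdeg_unscale[_ [c [e [_ /hdeg_ratmap]]]].
have [c [Dg gD]] := ratmap_hdeg rg.
have rHg : is_ratmap (triple_comp H g).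
  have [e] := ratmap_hdeg rTg; rewrite E scale_triple_comp.
  by case/hdeg_unscale => _ [? [? [_ /hdeg_ratmap]]].
have rgH : is_ratmap (triple_comp g H).
  have [e] := ratmap_hdeg rgT; rewrite E (comp_scale_triple _ _ gD).
  by case/hdeg_unscale => _ [? [? [_ /hdeg_ratmap]]].
have Hg : same_ratmap (triple_comp H g) (triple_id K).
  apply: same_trans rTg _ Tg; rewrite E scale_triple_comp.
  exact/same_symm/same_scale_triple.
have gH : same_ratmap (triple_comp g H) (triple_id K).
  apply: same_trans rgT _ gT; rewrite E (comp_scale_triple _ _ gD).
  exact/same_symm/same_scale_triple.
by split; [exact: rH|exists g; split; [exact: rg|exact: rHg|exact: Hg|exact: rgH|exact: gH]].
Qed.

End Triples.

(** * Reduced representatives and the degree of a birational map *)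

Section Representatives.
Variable K : fieldType.
Implicit Types (T H : triple K) (z w : Bir K).

(** A relation, so that statements about triples need not carry the proof of birationality on which
    a class depends. *)
Definition rep z T : Prop := exists bT : birational T, z = bir_class bT.

Lemma repM z w S T : rep z S -> rep w T -> rep (z * w)%g (triple_comp S T).
Proof.
by move=> [bS ->] [bT ->]; exists (birational_comp bS bT); apply: bir_mulE.
Qed.

Lemma rep1 : rep 1%g (triple_id K).
Proof. by exists (birational_id K). Qed.

Lemma rep_birational z T : rep z T -> birational T.
Proof. by case. Qed.

Lemma rep_ratmap z T : rep z T -> is_ratmap T.
Proof. by case=> [[]]. Qed.

Lemma rep_inj z w T : rep z T -> rep w T -> z = w.
Proof. by move=> [bT ->] [bT' ->]; apply/bir_classP/same_refl. Qed.

Lemma rep_same z T H : rep z T -> rep z H -> same_ratmap T H.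
Proof. by move=> [bT ->] [bH E]; apply/(bir_classP bT bH). Qed.

Lemma rep_unscale z C T : C != 0 -> rep z (scale_triple C T) -> rep z T.
Proof.
move=> C0 [b ->]; exists (birational_unscale C0 erefl b).
exact/bir_classP/same_scale_triple.
Qed.

Lemma reduced_rep_ex z : exists2 H, reduced H & rep z H.
Proof.
have rz : rep z (repr z) by exists (bir_birational (repr z)); rewrite bir_reprK.
have [C [H [C0 Hr E]]] := reduce_ex (rep_ratmap rz).
exists H; first exact: Hr.
by apply: (rep_unscale C0); rewrite -E; exact: rz.
Qed.

(** An arbitrary choice, determined up to a nonzero constant by [rep_reduced]; this is the origin of
    the factors [c%:MP] in later identities. *)
Definition red z : triple K := s2val (cid2 (reduced_rep_ex z)).

Lemma red_reduced z : reduced (red z).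
Proof. by rewrite /red; case: cid2. Qed.

Lemma rep_red z : rep z (red z).
Proof. by rewrite /red; case: cid2. Qed.

Lemma red_hdeg_ex z : exists d, hdeg (red z) d.
Proof. by apply/ratmap_hdeg/rep_ratmap/rep_red. Qed.

Definition bdeg z : nat := sval (cid (red_hdeg_ex z)).

Lemma red_hdeg z : hdeg (red z) (bdeg z).
Proof. by rewrite /bdeg; case: cid. Qed.

Lemma rep_scale z T : rep z T ->
  exists2 C : {mpoly K[3]}, C != 0 & T = scale_triple C (red z).
Proof.
move=> rT; have rr := rep_same rT (rep_red z).
exact: reduced_factor (rep_ratmap rT) (red_reduced z) rr.
Qed.

Lemma rep_hdeg z T d : rep z T -> hdeg T d ->
  exists C : {mpoly K[3]}, [/\ C != 0, C \is (d - bdeg z)%N.-homog, (bdeg z <= d)%N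
            & T = scale_triple C (red z)].
Proof.
move=> rT Td; have [C C0 E] := rep_scale rT; exists C.
move: Td; rewrite E => /hdeg_unscale[_ [c [e [Cc /hdeg_uniq/(_ (red_hdeg z)) ->  ->]]]].
by split; rewrite ?addnK ?leq_addl.
Qed.

Lemma rep_hdeg_eq z T : rep z T -> hdeg T (bdeg z) ->
  exists2 c, c != 0 & T = scale_triple c%:MP (red z).
Proof.
move=> rT /(rep_hdeg rT)[C [C0]]; rewrite subnn => /(homog0_unit C0).
by case/mpoly_unitP => c c0 -> _ ->; exists c.
Qed.

Lemma rep_reduced z T : rep z T -> reduced T ->
  exists2 c, c != 0 & T = scale_triple c%:MP (red z).
Proof.
move=> rT [_ Tr]; have [C C0 E] := rep_scale rT.
have [/mpoly_unitP[c c0 EC]|CU] := boolP (C \is a GRing.unit).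
  by exists c; rewrite // -EC.
have [p pp pC] := exists_prime_divisor C0 CU.
by case: (Tr p pp) => i; rewrite E tnth_mktuple; apply: divides_mulr.
Qed.

End Representatives.

(** * Congruences and Jacobians *)

Lemma big_ord3 (R : Type) (idx : R) (op : Monoid.law idx) (F : 'I_3 -> R) :
  \big[op/idx]_(i < 3) F i = op (op (F 0) (F 1)) (F 2%:R).
Proof.
rewrite !big_ord_recr big_ord0 /= Monoid.mul1m.
by congr (op (op (F _) (F _)) (F _)); apply: val_inj.
Qed.

Lemma det3 (R : comNzRingType) (M : 'M[R]_3) :
  \det M = M 0 0 * (M 1 1 * M 2%:R 2%:R - M 1 2%:R * M 2%:R 1)
         - M 0 1 * (M 1 0 * M 2%:R 2%:R - M 1 2%:R * M 2%:R 0)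
         + M 0 2%:R * (M 1 0 * M 2%:R 1 - M 1 1 * M 2%:R 0).
Proof.
pose m a b := M (inord a) (inord b).
have E i j : M i j = m i j by rewrite /m !inord_val.
rewrite !E (expand_det_row _ 0) big_ord3 /cofactor !(expand_det_row _ 0).
rewrite !big_ord_recr !big_ord0 /= /cofactor !det_mx11 !mxE !E /=.
by rewrite /bump /= ?addn0 ?add0n ?expr0 ?expr1 ?expr2; ring.
Qed.

Section Congruences.
Variable R : idomainType.
Implicit Types a b c m : R.

Definition cong m a b : Prop := divides m (a - b).

Lemma cong_refl m a : cong m a a.
Proof. by rewrite /cong subrr; apply: divides0. Qed.

Lemma cong_sym m a b : cong m a b -> cong m b a.
Proof. by move=> /dividesN; rewrite opprB. Qed.

Lemma congD m a b c d : cong m a b -> cong m c d -> cong m (a + c) (b + d).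
Proof. by move=> ab cd; have := dividesD ab cd; congr divides; ring. Qed.

Lemma congM m a b c d : cong m a b -> cong m c d -> cong m (a * c) (b * d).
Proof.
move=> [x Ex] [y Ey]; exists (x * c + b * y).
by rewrite mulrDr mulrA -Ex mulrCA -Ey; ring.
Qed.

Lemma congX m a b n : cong m a b -> cong m (a ^+ n) (b ^+ n).
Proof.
move=> ab; elim: n => [|n IHn]; first exact: cong_refl.
by rewrite !exprS; apply: congM.
Qed.

Lemma cong_divides m a b : cong m a b -> divides m b -> divides m a.
Proof. by move=> ab mb; have := dividesD ab mb; rewrite subrK. Qed.

Lemma cong_det m n (M N : 'M[R]_n) : (forall i j, cong m (M i j) (N i j)) ->
  cong m (\det M) (\det N).
Proof.
move=> MN; rewrite /determinant.
apply: (big_ind2 (cong m)) => [||s _]; [exact: cong_refl|exact: congD|].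
apply: congM; first exact: cong_refl.
by apply: (big_ind2 (cong m)) => [||i _]; [exact: cong_refl|exact: congM|].
Qed.

End Congruences.

Lemma cong_comp (K : fieldType) n k (m : {mpoly K[k]}) (p : {mpoly K[n]})
    (S T : n.-tuple {mpoly K[k]}) :
  (forall i, cong m (tnth S i) (tnth T i)) -> cong m (p \mPo S) (p \mPo T).
Proof.
move=> ST; rewrite !comp_mpolyE.
apply: (big_ind2 (cong m)) => [||u _]; [exact: cong_refl|exact: congD|].
rewrite -!mul_mpolyC; apply: congM; first exact: cong_refl.
apply: (big_ind2 (cong m)) => [||i _]; [exact: cong_refl|exact: congM|].
exact: congX.
Qed.

Lemma submm n (m : 'X_{1..n}) : (m - m = 0)%MM.
Proof. by apply/mnmP => i; rewrite mnmBE subnn mnm0E. Qed.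

Section Calculus.
Variables (K : fieldType) (n : nat).
Implicit Types (p q : {mpoly K[n]}).

Lemma mderiv_homog p d i : p \is d.-homog -> p^`M(i) \is d.-1.-homog.
Proof.
move=> /dhomogP pd; apply/dhomogP => m; rewrite mcoeff_msupp mcoeff_mderiv => h.
have /pd <- : (m + U_(i))%MM \in msupp p.
  by rewrite mcoeff_msupp; apply: contraNneq h => ->; rewrite mul0rn.
by rewrite /= mdegD mdeg1 addn1.
Qed.

Lemma mderiv_comp k p (T : n.-tuple {mpoly K[k]}) j :
  (p \mPo T)^`M(j) = \sum_(i < n) (p^`M(i) \mPo T) * (tnth T i)^`M(j).
Proof.
pose P q := (q \mPo T)^`M(j) = \sum_(i < n) (q^`M(i) \mPo T) * (tnth T i)^`M(j).
have PC c : P c%:MP.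
  rewrite /P comp_mpolyC mderivC big1 // => i _.
  by rewrite mderivC comp_mpoly0 mul0r.
have PD q r : P q -> P r -> P (q + r).
  rewrite /P !rmorphD /= !mderivD => -> ->; rewrite -big_split /=.
  by apply: eq_bigr => i _; rewrite mderivD comp_mpolyD mulrDl.
have PM q r : P q -> P r -> P (q * r).
  rewrite /P !rmorphM /= !mderivM => -> ->; rewrite mulr_suml mulr_sumr -big_split /=.
  by apply: eq_bigr => i _; rewrite mderivM comp_mpolyD !rmorphM /=; ring.
have PX i : P 'X_i.
  rewrite /P comp_mpolyXU -tnth_nth (bigD1 i) //= big1 => [|l li].
    by rewrite mderivX mnm1E eqxx scale1r submm mpolyX0 comp_mpoly1 mul1r addr0.
  by rewrite mderivX mnm1E eq_sym (negPf li) scale0r comp_mpoly0 mul0r.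
rewrite -/(P p) [p]mpolyE; apply: (big_ind P) => [||m _]; first by rewrite -mpolyC0.
  by move=> q r; apply: PD.
rewrite -mul_mpolyC mpolyXE_id; apply: (PM) => //.
apply: (big_ind P) => [||i _]; first by rewrite -mpolyC1.
  by move=> q r; apply: PM.
elim: (m i) => [|l IHl]; first by rewrite expr0 -mpolyC1.
by rewrite exprS; apply: PM.
Qed.

Lemma euler_homog p d : p \is d.-homog ->
  \sum_(i < n) 'X_i * p^`M(i) = p *+ d.
Proof.
move=> /dhomogP pd; rewrite [in RHS](mpolyE p) -sumrMnl.
transitivity (\sum_(i < n) \sum_(m <- msupp p) 'X_i * (p@_m *: 'X_[m])^`M(i)).
  by apply: eq_bigr => i _; rewrite {1}[p]mpolyE raddf_sum mulr_sumr.
rewrite exchange_big /=; apply: eq_big_seq => m /pd mE.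
rewrite -mE /= mdegE -sumrMnr; apply: eq_bigr => i _.
rewrite mderivZ mderivX -!scalerAr scalerA.
have [->|mi] := eqVneq (m i) 0%N; first by rewrite mulr0 scale0r mulr0n.
rewrite -mpolyXD [(U_(i) + _)%MM]addmC submK ?lep1mP //.
by rewrite mulr_natr scalerMnl.
Qed.

End Calculus.

Section Jacobian.
Variable K : fieldType.
Implicit Types (S T : triple K) (C : {mpoly K[3]}).

Definition jac T : {mpoly K[3]} := \det (\matrix_(i, j) (tnth T i)^`M(j)).

Lemma jac_comp S T : jac (triple_comp S T) = (jac S \mPo T) * jac T.
Proof.
rewrite {1}/jac (_ : \matrix_(i, j) _ =
  map_mx (comp_mpoly T) (\matrix_(i, j) (tnth S i)^`M(j)) *m
  (\matrix_(i, j) (tnth T i)^`M(j))); first by rewrite det_mulmx det_map_mx.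
apply/matrixP => i j; rewrite !mxE tnth_mktuple mderiv_comp.
by apply: eq_bigr => k _; rewrite !mxE.
Qed.

Lemma jac_homog T d : (forall i, tnth T i \is d.-homog) ->
  jac T \is (3 * d.-1)%N.-homog.
Proof.
move=> Td; have H i j := mderiv_homog j (Td i).
rewrite /jac det3 !mxE.
have -> : (3 * d.-1 = d.-1 + (d.-1 + d.-1))%N by lia.
by rewrite rpredD ?rpredB // dhomogM // rpredB // dhomogM.
Qed.

(** The Jacobian matrix is [C] times the identity plus the rank-one matrix x_i dC/dx_j. Its
    determinant is C^2 (C + sum of x_j dC/dx_j), and Euler's identity turns the second factor into
    (e + 1) C. *)
Lemma jac_scale_id C e : C \is e.-homog ->
  jac (scale_triple C (triple_id K)) = C ^+ 3 *+ e.+1.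
Proof.
move=> Ce; have := euler_homog Ce; rewrite big_ord3 /= => eu.
have E (i j : 'I_3) : ('X_i : {mpoly K[3]})^`M(j) = (i == j)%:R.
  rewrite mderivX mnm1E; case: eqP => [->|_]; last by rewrite scale0r.
  by rewrite scale1r submm mpolyX0.
rewrite /jac det3 !mxE !tnth_mktuple !mderivM !E !eqxx.
rewrite -![0 == _ :> 'I_3]/false -![1 == _ :> 'I_3]/false -![2%:R == _ :> 'I_3]/false.
rewrite -[false%:R]/(0 : {mpoly K[3]}) -[true%:R]/(1 : {mpoly K[3]}).
rewrite [RHS]mulrS -[C ^+ 3 *+ e]mulr_natr; rewrite -[C *+ e]mulr_natr in eu.
move/eqP: eu; rewrite -addrA eq_sym -subr_eq eq_sym => /eqP eu.
by ring: eu.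
Qed.

End Jacobian.

(** * Contraction of curves to points, expressed by congruences *)

Section Parallel.
Variable K : fieldType.
Implicit Types (S T : triple K) (m p C : {mpoly K[3]}) (v w : 'cV[K]_3).

(* T contracts the curve m = 0 to the point v. *)
Definition parallel m T v : Prop :=
  forall i j, divides m (v j 0 *: tnth T i - v i 0 *: tnth T j).

Definition collinear v w : Prop := forall i j, v i 0 * w j 0 = v j 0 * w i 0.

Lemma congP m a b : cong m a b -> exists c, a = b + m * c.
Proof. by move=> [c Ec]; exists c; rewrite -Ec addrC subrK. Qed.

Definition teval T v : 'cV[K]_3 := \col_i (tnth T i).@[fun k => v k 0].

Lemma nz_coord v : v != 0 -> exists j, v j 0 != 0.
Proof.
move=> v0; apply: contrapT => /forallNP H; case/eqP: v0.
apply/colP => i; rewrite mxE; apply/eqP.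
by case: eqP (H i) => // ? [].
Qed.

Lemma parallel_cong m T v j : v j 0 != 0 -> parallel m T v ->
  forall i, cong m (tnth T i) (((v j 0)^-1 *: tnth T j) * (v i 0)%:MP).
Proof.
move=> vj mTv i; have [c Ec] := mTv i j.
exists ((v j 0)^-1 *: c); rewrite -scalerAr -Ec scalerBr !scalerA mulVf // scale1r.
by congr (_ - _); rewrite mulrC mul_mpolyC scalerA mulrC.
Qed.

Lemma cong_parallel m T v y : (forall i, cong m (tnth T i) (y * (v i 0)%:MP)) ->
  parallel m T v.
Proof.
move=> H i j; have [a Ea] := congP (H i); have [b Eb] := congP (H j).
exists (v j 0 *: a - v i 0 *: b).
by rewrite Ea Eb -!mul_mpolyC; ring.
Qed.

Lemma parallel_div m m' T v : divides m' m -> parallel m T v -> parallel m' T v.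
Proof. by move=> mm H i j; apply: divides_trans mm (H i j). Qed.

Lemma cong_homog m T v y P d : P \is d.-homog ->
  (forall i, cong m (tnth T i) (y * (v i 0)%:MP)) ->
  cong m (P \mPo T) (y ^+ d * (P.@[fun k => v k 0])%:MP).
Proof.
move=> Pd H; pose V : triple K := [tuple (v i 0)%:MP | i < 3].
have -> : (P.@[fun k => v k 0])%:MP = P \mPo V.
  rewrite mevalE comp_mpolyE rmorph_sum; apply: eq_bigr => u _ /=.
  rewrite rmorphM rmorph_prod /= mul_mpolyC; congr (_ *: _).
  by apply: eq_bigr => i _; rewrite rmorphXn tnth_mktuple.
rewrite -(comp_scale _ _ Pd); apply: cong_comp => i.
by rewrite !tnth_mktuple; apply: H.
Qed.

Lemma reduced_coord T p v j : reduced T -> prime_elt p -> parallel p T v ->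
  v j 0 != 0 -> ~ divides p ((v j 0)^-1 *: tnth T j).
Proof.
move=> [_ Tr] pp pTv vj pj; apply: (Tr p pp) => i.
apply: cong_divides (parallel_cong vj pTv i) _; exact: divides_mulr.
Qed.

Lemma prime_const p c : prime_elt p -> c != 0 -> ~ divides p (c%:MP_[3] : {mpoly K[3]}).
Proof.
by move=> pp c0 pc; apply: (prime_unit pp); exists c%:MP; first exact: mpolyC_unit.
Qed.

(** Modulo [p ^+ s] the composite is y^d S(v), and [p] does not divide [y] because [T] is reduced.
    As S(v) is nonzero, [p] cannot divide [C] either, so [C] cancels from the congruences. *)
Lemma parallel_comp S T T' C p s v d : reduced T -> prime_elt p -> (0 < s)%N ->
  (forall i, tnth S i \is d.-homog) -> v != 0 -> teval S v != 0 ->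
  triple_comp S T = scale_triple C T' ->
  parallel (p ^+ s) T v -> parallel (p ^+ s) T' (teval S v).
Proof.
move=> Tr pp s0 Sd /nz_coord[j vj] /nz_coord[k wk] E psT.
have pT : parallel p T v by apply: parallel_div psT; apply: divides_exp.
have py := reduced_coord Tr pp pT vj; set y := _ *: _ in py.
have H := fun i => cong_homog (Sd i) (parallel_cong vj psT); rewrite -/y in H.
have ST i : tnth S i \mPo T = C * tnth T' i.
  by move/(congr1 (fun t => tnth t i)): E; rewrite !tnth_mktuple.
have pC : ~ divides p C.
  move=> pC; have : divides p (y ^+ d * (teval S v k 0)%:MP).
    rewrite mxE; apply: cong_divides (divides_mulr (tnth T' k) pC).
    rewrite -ST; apply: cong_sym; apply: divides_trans (H k).
    exact: divides_exp.
  by case: (pp) => _ _ h /h[/(prime_exp pp)//|/(prime_const pp wk)].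
move=> a b; apply: (prime_cancel pp pC).
have Ha := H a; have Hb := H b; rewrite !ST in Ha Hb.
have [x Ex] := congP Ha; have [z Ez] := congP Hb.
exists (teval S v b 0 *: x - teval S v a 0 *: z).
by rewrite !mxE -!mul_mpolyC mulrBr ![C * (_ * _)]mulrCA Ex Ez; ring.
Qed.

Lemma parallel_uniq T p v w : reduced T -> prime_elt p -> v != 0 -> w != 0 ->
  parallel p T v -> parallel p T w -> collinear v w.
Proof.
move=> Tr pp /nz_coord[k vk] _ pTv pTw i j; apply/eqP; rewrite -subr_eq0.
apply/negPn/negP => /(prime_const pp) H; apply: H.
have py := reduced_coord Tr pp pTv vk; set y := _ *: _ in py.
have [x Ex] := congP (parallel_cong vk pTv i).
have [z Ez] := congP (parallel_cong vk pTv j).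
have [u Eu] := pTw i j; rewrite -/y in Ex Ez.
have : divides p (y * (v i 0 * w j 0 - v j 0 * w i 0)%:MP).
  exists (u - w j 0 *: x + w i 0 *: z).
  rewrite mulrDr mulrBr -Eu Ex Ez -!mul_mpolyC !rmorphB !rmorphM /=; ring.
by case: pp => _ _ h /h[].
Qed.

(** Write T_i = m h_i + y v_i. Modulo [m] the Jacobian matrix is the sum of the rank-one matrices
    v_i dy/dx_j and h_i dm/dx_j, so its determinant vanishes. For [m] a prime power this records the
    multiplicity of the contracted curve. *)
Lemma parallel_jac m T v : v != 0 -> parallel m T v -> divides m (jac T).
Proof.
move=> /nz_coord[k vk] mT; have := parallel_cong vk mT; set y := _ *: _ => H.
have [h Eh] := choice H.
have E i j : (tnth T i)^`M(j) = m * (h i)^`M(j)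
   + (y^`M(j) * (v i 0)%:MP + h i * m^`M(j)).
  have -> : tnth T i = m * h i + y * (v i 0)%:MP by rewrite -Eh subrK.
  by rewrite mderivD !mderivM mderivC; ring.
pose N : 'M[{mpoly K[3]}]_3 := \matrix_(i, j) (y^`M(j) * (v i 0)%:MP + h i * m^`M(j)).
apply: cong_divides (_ : cong m _ (\det N)) _.
  by apply: cong_det => i j; rewrite !mxE E; exists ((h i)^`M(j)); ring.
suff -> : \det N = 0 by apply: divides0.
by rewrite det3 !mxE; ring.
Qed.

End Parallel.

Section JacobianNonzero.
Variable K : numFieldType.

Lemma jac_id : jac (triple_id K) = 1.
Proof.
by rewrite -[triple_id K]scale_triple1 (jac_scale_id (dhomog1 _ _)) expr1n.
Qed.

(** Modulo a common prime factor [T] is zero, hence proportional to any vector, here (1, 1, 1); that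
    prime would divide the Jacobian. *)
Lemma jac_unit_reduced (T : triple K) :
  is_ratmap T -> jac T \is a GRing.unit -> reduced T.
Proof.
move=> rT jU; split=> // p pp H.
have v0 : (\col__ 1 : 'cV[K]_3) != 0.
  by apply/eqP => /colP /(_ 0) /eqP; rewrite !mxE oner_eq0.
apply: (prime_unit pp); exists (jac T) => //; apply: (parallel_jac v0) => i j.
by apply: dividesB; rewrite -mul_mpolyC; apply: divides_mull; apply: H.
Qed.

Lemma reduced_id : reduced (triple_id K).
Proof. by apply: jac_unit_reduced (is_ratmap_id K) _; rewrite jac_id unitr1. Qed.

(** With an inverse [g], the composite [g] after [T] is C times the identity, whose Jacobian (e + 1)
    C^3 is nonzero in characteristic zero; the chain rule exhibits [jac T] as a factor of it. *)
Lemma jac_neq0 (T : triple K) : birational T -> jac T != 0.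
Proof.
move=> [rT [g [rg _ _ rgT gT]]].
have [C C0 E] := reduced_factor rgT reduced_id gT.
have [d] := ratmap_hdeg rgT; rewrite E => /hdeg_unscale[_ [e [_ [Ce _ _]]]].
have : jac (triple_comp g T) != 0.
  rewrite E (jac_scale_id Ce) -mulr_natr mulf_neq0 ?expf_neq0 //.
  by rewrite -mpolyC_nat mpolyC_eq0 pnatr_eq0.
by rewrite jac_comp mulf_eq0 negb_or => /andP[].
Qed.

End JacobianNonzero.

(** * Quadratic maps and degrees *)

Lemma ord3P (i : 'I_3) : [\/ i = 0, i = 1 | i = 2%:R].
Proof.
by case: i => -[|[|[|//]]] Hi; [constructor 1|constructor 2|constructor 3];
  apply: val_inj.
Qed.

(** Since [p] divides only one of the factors, that factor must carry the whole power. *)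
Lemma prime_power_prod (R : idomainType) (I : finType) (c : I -> R) p n :
  prime_elt p -> (0 < n)%N ->
  (forall x y, divides p (c x) -> divides p (c y) -> x = y) ->
  divides (p ^+ n) (\prod_x c x) -> exists x, divides (p ^+ n) (c x).
Proof.
move=> pp n0 uniq pn.
have [x px] : exists x, divides p (c x).
  apply: (prime_prod pp); apply: divides_trans pn; exact: divides_exp.
exists x; move: pn; rewrite (bigD1 x) //=; apply: (prime_cancelr pp).
rewrite -big_filter => /(prime_prod_mem pp)[y]; rewrite mem_filter => /andP[yx _].
by move=> /(uniq x y px) E; rewrite E eqxx in yx.
Qed.

Lemma homog_prod_fin (K : fieldType) n (I : finType) (c : I -> {mpoly K[n]})
    (d : I -> nat) :
  (forall x, c x \is (d x).-homog) -> \prod_x c x \is (\sum_x d x)%N.-homog.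
Proof.
move=> H; apply: (big_rec2 (fun p e => p \is e.-homog)); first exact: dhomog1.
by move=> x e p _; apply: dhomogM.
Qed.

Definition sigma_vec (A : comNzRingType) (v : 'cV[A]_3) : 'cV[A]_3 :=
  \col_i (if i == 0 then v 1 0 * v 2%:R 0
          else if i == 1 then v 0 0 * v 2%:R 0 else v 0 0 * v 1 0).

Section Quadratic.
Variable K : numFieldType.
Implicit Types (L R : 'M[K]_3) (T : triple K) (v : 'cV[K]_3).

(** Two matrices make the family stable under inversion: the inverse of L sigma R is R^-1 sigma
    L^-1. Every statement about f then applies to f^-1. *)
Definition quad L R : triple K :=
  triple_comp (linear_triple L) (triple_comp (sigma_triple K) (linear_triple R)).

Definition base_vec i : 'cV[K]_3 := delta_mx i 0.

(* For f = L sigma R this is the point f^-k (R^-1 e_i); those with k < n are the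
   base points of f^n. *)
Definition base_point L R i k : 'cV[K]_3 :=
  iter k (fun v => invmx R *m sigma_vec (invmx L *m v)) (invmx R *m base_vec i).

(* Exchanging (L, R) and (R^-1, L^-1) exchanges f and f^-1, so that b = false
   gives the points f^k (L e_i), the base points of the powers of f^-1. *)
Definition orbit_point L R (b : bool) i k : 'cV[K]_3 :=
  if b then base_point L R i k else base_point (invmx R) (invmx L) i k.

(** Nonvanishing of the vectors says that these orbits never meet an indeterminacy point, so that
    all of them are genuine points of the plane. *)
Definition generic L R : Prop :=
  (forall b i k, orbit_point L R b i k != 0) /\
  (forall b i k b' i' k', collinear (orbit_point L R b i k) (orbit_point L R b' i' k') ->
     [/\ b = b', i = i' & k = k']).

Lemma generic_inv L R : generic L R -> generic (invmx R) (invmx L).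
Proof.
have E b i k : orbit_point (invmx R) (invmx L) b i k = orbit_point L R (~~ b) i k.
  by case: b; rewrite /orbit_point //= !invmxK.
move=> [g0 gc]; split=> [b i k|b i k b' i' k']; first by rewrite E.
by rewrite !E => /gc[/negb_inj].
Qed.

Lemma sigma_tripleE i : tnth (sigma_triple K) i =
  if i == 0 then 'X_1 * 'X_2%:R else if i == 1 then 'X_0 * 'X_2%:R else 'X_0 * 'X_1.
Proof. by have [->|->|->] := ord3P i; rewrite (tnth_nth 0). Qed.

Lemma sigma_comp T i : tnth (triple_comp (sigma_triple K) T) i =
  if i == 0 then tnth T 1 * tnth T 2%:R else if i == 1 then tnth T 0 * tnth T 2%:R
  else tnth T 0 * tnth T 1.
Proof.
rewrite tnth_comp sigma_tripleE; case: ifP => _; [|case: ifP => _];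
by rewrite rmorphM /= !comp_mpolyXU -!tnth_nth.
Qed.

Lemma linear_comp L T i :
  tnth (triple_comp (linear_triple L) T) i = \sum_j L i j *: tnth T j.
Proof.
rewrite tnth_comp tnth_mktuple raddf_sum; apply: eq_bigr => j _ /=.
by rewrite comp_mpolyZ comp_mpolyXU -tnth_nth.
Qed.

Lemma linear_compK L T : L \in unitmx ->
  triple_comp (linear_triple (invmx L)) (triple_comp (linear_triple L) T) = T.
Proof.
by move=> uL; rewrite triple_compA -linear_tripleM mulVmx // linear_triple1 triple_1comp.
Qed.

Lemma linear_homog L T d : (forall i, tnth T i \is d.-homog) ->
  forall i, tnth (triple_comp (linear_triple L) T) i \is d.-homog.
Proof. by move=> Td i; rewrite linear_comp rpred_sum // => j _; apply: dhomogZ. Qed.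

Lemma quad_comp L R T : triple_comp (quad L R) T = triple_comp (linear_triple L)
  (triple_comp (sigma_triple K) (triple_comp (linear_triple R) T)).
Proof.
by rewrite /quad -(triple_compA (linear_triple L)) -(triple_compA (sigma_triple K)).
Qed.

Lemma quad_homog L R i : tnth (quad L R) i \is 2.-homog.
Proof.
apply: linear_homog => {}i; rewrite sigma_comp.
have H j : tnth (linear_triple R) j \is 1.-homog.
  rewrite -[linear_triple R]triple_comp1; apply: linear_homog => k.
  by rewrite tnth_mktuple dhomogX /= mdeg1.
by case: ifP => _; [|case: ifP => _]; apply: (@dhomogM _ _ _ 1 _ 1).
Qed.

Lemma teval_quad L R v : teval (quad L R) v = L *m sigma_vec (R *m v).
Proof.
have HL (M : 'M[K]_3) T : teval (triple_comp (linear_triple M) T) v = M *m teval T v.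
  apply/colP => i; rewrite !mxE linear_comp rmorph_sum; apply: eq_bigr => j _ /=.
  by rewrite mevalZ mxE.
have id : teval (triple_id K) v = v by apply/colP => i; rewrite mxE tnth_mktuple mevalXU.
rewrite HL; congr (_ *m _).
have <- : teval (linear_triple R) v = R *m v.
  by rewrite -[linear_triple R]triple_comp1 HL id.
apply/colP => i; rewrite [LHS]mxE sigma_comp !mxE.
by case: ifP => _; [|case: ifP => _]; rewrite mevalM.
Qed.

Lemma linear_parallel L T m i : (forall j, j != i -> divides m (tnth T j)) ->
  parallel m (triple_comp (linear_triple L) T) (L *m base_vec i).
Proof.
move=> H; apply: (@cong_parallel _ _ _ _ (tnth T i)) => a.
have -> : (L *m base_vec i) a 0 = L a i.
  rewrite mxE (bigD1 i) //= big1 ?addr0; last by move=> j ji; rewrite mxE (negPf ji) mulr0.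
  by rewrite mxE !eqxx mulr1.
rewrite linear_comp (bigD1 i) //= /cong [_ *: _ + _]addrC -mul_mpolyC mulrC addrK.
apply: (big_ind (divides m)) => [||j ji]; [exact: divides0|exact: dividesD|].
by rewrite -mul_mpolyC; apply/divides_mull/H.
Qed.

(* The line contracted by f is mapped to the point L e_i. *)
Lemma quad_contracts L R T m i :
  divides m (tnth (triple_comp (linear_triple R) T) i) ->
  parallel m (triple_comp (quad L R) T) (L *m base_vec i).
Proof.
rewrite quad_comp; move: (triple_comp (linear_triple R) T) => y mi.
apply: linear_parallel => j; rewrite sigma_comp; move: mi.
have [->|->|->] := ord3P i; have [->|->|->] := ord3P j => //= mi _;
by do [exact: divides_mulr|exact: divides_mull].
Qed.

Lemma linear_divides L T m : (forall i, divides m (tnth T i)) ->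
  forall i, divides m (tnth (triple_comp (linear_triple L) T) i).
Proof.
move=> mT i; rewrite linear_comp.
apply: (big_ind (divides m)) => [||j _]; [exact: divides0|exact: dividesD|].
by rewrite -mul_mpolyC; apply: divides_mull.
Qed.

Lemma sigma_common_factor T p s : prime_elt p ->
  ~ (forall i, divides p (tnth T i)) ->
  (forall i, divides (p ^+ s) (tnth (triple_comp (sigma_triple K) T) i)) ->
  exists i, forall j, j != i -> divides (p ^+ s) (tnth T j).
Proof.
move=> pp /existsNP[i pi] ps; exists i => j ji.
have {ps}[p0 p1 p2] : [/\ divides (p ^+ s) (tnth T 1 * tnth T 2%:R),
  divides (p ^+ s) (tnth T 0 * tnth T 2%:R) & divides (p ^+ s) (tnth T 0 * tnth T 1)].
  by split; [have := ps 0|have := ps 1|have := ps 2%:R]; rewrite sigma_comp.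
move: pi ji; have [->|->|->] := ord3P i; have [->|->|->] := ord3P j => //= pi _;
by do [apply: (prime_cancel pp pi); assumption|apply: (prime_cancelr pp pi); assumption].
Qed.

(** Put y = R T. Some y_i is not divisible by [p], whereas [p ^+ s] divides all pairwise products;
    hence it divides the two other coordinates. Thus y is contracted to e_i, and [T] to R^-1 e_i. *)
Lemma quad_common_factor L R T p s : L \in unitmx -> R \in unitmx ->
  reduced T -> prime_elt p ->
  (forall i, divides (p ^+ s) (tnth (triple_comp (quad L R) T) i)) ->
  exists i, parallel (p ^+ s) T (invmx R *m base_vec i).
Proof.
move=> uL uR [_ /(_ p)] + pp /(linear_divides (invmx L)); rewrite quad_comp linear_compK //.
rewrite -{1 3}[T](linear_compK T uR); move: (triple_comp (linear_triple R) T) => y pT py.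
have [|i H] := sigma_common_factor pp _ py; last by exists i; apply: linear_parallel.
by move=> /(linear_divides (invmx R)); apply: pT.
Qed.

End Quadratic.

(** * Dropped factors and degrees along the orbit of a birational map *)

Section Degrees.
Variable K : numFieldType.
Implicit Types (L R : 'M[K]_3) (T : triple K) (v : 'cV[K]_3) (f z : Bir K).

Lemma rep_linear L : L \in unitmx -> exists l, rep l (linear_triple L).
Proof. by move=> uL; exists (bir_class (birational_linear uL)), (birational_linear uL). Qed.

Lemma rep_sigma : rep (sigma K) (sigma_triple K).
Proof. by exists (birational_sigma K). Qed.

Lemma rep_linearV L l : L \in unitmx -> rep l (linear_triple L) ->
  rep l^-1%g (linear_triple (invmx L)).
Proof.
move=> uL rl; have [l' rl'] : exists l', rep l' (linear_triple (invmx L)).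
  by apply: rep_linear; rewrite unitmx_inv.
suff -> : (l^-1 = l')%g by [].
apply: mulg1_eq; apply: (rep_inj (T := triple_id K)); last exact: rep1.
by rewrite -linear_triple1 -(mulmxV uL) linear_tripleM; exact: (repM rl rl').
Qed.

Lemma sigmaV : ((sigma K)^-1 = sigma K)%g.
Proof.
apply: mulg1_eq; apply: (rep_inj (T := triple_id K)); last exact: rep1.
apply: (@rep_unscale _ _ ('X_0 * 'X_1 * 'X_2%:R)); first by rewrite !mulf_neq0 ?mpolyX_eq0.
have -> : scale_triple ('X_0 * 'X_1 * 'X_2%:R) (triple_id K)
    = triple_comp (sigma_triple K) (sigma_triple K).
  apply: eq_from_tnth => i; rewrite sigma_comp !tnth_mktuple !sigma_tripleE /=.
  by have [->|->|->] := ord3P i; rewrite /=; ring.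
exact: (repM rep_sigma rep_sigma).
Qed.

Lemma rep_quad l r L R : rep l (linear_triple L) -> rep r (linear_triple R) ->
  rep (l * (sigma K * r))%g (quad L R).
Proof. move=> rl rr; exact: (repM rl (repM rep_sigma rr)). Qed.

Lemma rep_quadV f L R : L \in unitmx -> R \in unitmx -> rep f (quad L R) ->
  rep f^-1%g (quad (invmx R) (invmx L)).
Proof.
move=> uL uR rf; have [l rl] := rep_linear uL; have [r rr] := rep_linear uR.
have -> : f = (l * (sigma K * r))%g by apply: rep_inj rf (rep_quad rl rr).
rewrite !invgM sigmaV -mulgA.
exact: (rep_quad (rep_linearV uR rr) (rep_linearV uL rl)).
Qed.

Lemma comp_hdeg z w S d : rep z S -> hdeg S d -> hdeg (triple_comp S (red w)) (d * bdeg w).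
Proof.
move=> rS [_ Sd]; have [] := rep_ratmap (repM rS (rep_red w)); split=> // i.
by rewrite tnth_comp; apply: comp_homog (Sd i) _; case: (red_hdeg w).
Qed.

Section Step.
Variables (f : Bir K) (L R : 'M[K]_3).
Hypotheses (uL : L \in unitmx) (uR : R \in unitmx) (rf : rep f (quad L R)).

Lemma quad_hdeg : hdeg (quad L R) 2.
Proof. by have [f0 _] := rep_ratmap rf; split=> //; apply: quad_homog. Qed.

Lemma quad_step z : exists C, [/\ C != 0,
  C \is (2 * bdeg z - bdeg (f * z)%g)%N.-homog, (bdeg (f * z)%g <= 2 * bdeg z)%N
  & triple_comp (quad L R) (red z) = scale_triple C (red (f * z)%g)].
Proof. exact: rep_hdeg (repM rf (rep_red z)) (comp_hdeg z rf quad_hdeg). Qed.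

Lemma parallel_step z p s v : prime_elt p -> (0 < s)%N -> v != 0 ->
  teval (quad L R) v != 0 -> parallel (p ^+ s) (red z) v ->
  parallel (p ^+ s) (red (f * z)%g) (teval (quad L R) v).
Proof.
move=> pp s0 v0 fv0; have [C [_ _ _ E]] := quad_step z.
exact: parallel_comp (red_reduced z) pp s0 (quad_homog L R) v0 fv0 E.
Qed.

Lemma parallel_iter z p s v k : prime_elt p -> (0 < s)%N ->
  (forall j, (j <= k)%N -> iter j (teval (quad L R)) v != 0) ->
  parallel (p ^+ s) (red z) v ->
  parallel (p ^+ s) (red (f ^+ k * z)%g) (iter k (teval (quad L R)) v).
Proof.
move=> pp s0 v0 H; elim: k v0 => [|k IHk] v0; first by rewrite expg0 mul1g.
rewrite expgS -mulgA iterS; apply: parallel_step => //; first exact: v0.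
  exact: (v0 k.+1).
by apply: IHk => j jk; apply/v0/leqW.
Qed.

End Step.

Lemma base_pointE L R i k : base_point L R i k =
  iter k (teval (quad (invmx R) (invmx L))) (invmx R *m base_vec K i).
Proof. by apply: eq_iter => v; rewrite teval_quad. Qed.

Section Contracted.
Variables (f : Bir K) (L R : 'M[K]_3).
Hypotheses (uL : L \in unitmx) (uR : R \in unitmx) (rf : rep f (quad L R)).
Hypothesis gLR : generic L R.

(* The curves dropped when passing from f^k z to f^(k+1) z are contracted by z
   to base points of f^(k+1). *)
Lemma factor_contracted z k C p s : prime_elt p -> (0 < s)%N ->
  triple_comp (quad L R) (red (f ^+ k * z)%g)
    = scale_triple C (red (f * (f ^+ k * z))%g) ->
  divides (p ^+ s) C -> exists i, parallel (p ^+ s) (red z) (base_point L R i k).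
Proof.
move=> pp s0 E pC.
have [|i Hi] := quad_common_factor (s := s) uL uR (red_reduced (f ^+ k * z)%g) pp.
  by move=> i; rewrite E tnth_mktuple; apply: divides_mulr.
exists i; rewrite base_pointE; have rV := rep_quadV uL uR rf.
(* The curve is contracted by f^k z to R^-1 e_i; applying f^-k carries this point to
   [base_point L R i k], through nonzero vectors only. *)
have -> : z = (f^-1 ^+ k * (f ^+ k * z))%g by rewrite expVgn mulKg.
apply: (parallel_iter rV pp s0 _ Hi) => j _; rewrite -base_pointE.
by case: gLR => g0 _; apply: (g0 true).
Qed.

End Contracted.

(* Noether's inequality: the curves dropped along the orbit of z are contracted
   by z to pairwise distinct points, so their product divides the Jacobian of z. *)
Lemma degree_drop_bound f L R z N : L \in unitmx -> R \in unitmx ->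
  rep f (quad L R) -> generic L R ->
  (\sum_(k < N) (2 * bdeg (f ^+ k * z)%g - bdeg (f ^+ k.+1 * z)%g)
   + \sum_(k < N) (2 * bdeg (f^-1 ^+ k * z)%g - bdeg (f^-1 ^+ k.+1 * z)%g)
   <= 3 * (bdeg z).-1)%N.
Proof.
move=> uL uR rf gLR; have rV := rep_quadV uL uR rf; have gV := generic_inv gLR.
have [uL' uR'] : invmx L \in unitmx /\ invmx R \in unitmx by rewrite !unitmx_inv.
pose g (b : bool) := if b then f else (f^-1)%g.
pose dg (x : bool * 'I_N) :=
  (2 * bdeg (g x.1 ^+ x.2 * z)%g - bdeg (g x.1 ^+ x.2.+1 * z)%g)%N.
(* [c (b, k)] is the factor dropped at step k, along the powers of f if [b] is true and along those
   of f^-1 otherwise. *)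
have /choice[c Hc] : forall x : bool * 'I_N, exists C : {mpoly K[3]},
    [/\ C != 0, C \is (dg x).-homog & forall p s, prime_elt p -> (0 < s)%N ->
      divides (p ^+ s) C -> exists i, parallel (p ^+ s) (red z) (orbit_point L R x.1 i x.2)].
  move=> [[] k]; rewrite /dg /g /= expgS -mulgA.
    have [C [C0 Ch _ E]] := quad_step rf (f ^+ k * z)%g.
    exists C; split=> // p s pp s0; exact: factor_contracted uL uR rf gLR _ _ _ _ _ pp s0 E.
  have [C [C0 Ch _ E]] := quad_step rV (f^-1 ^+ k * z)%g.
  exists C; split=> // p s pp s0; exact: factor_contracted uR' uL' rV gV _ _ _ _ _ pp s0 E.
have c0 x : c x != 0 by case: (Hc x).
have P0 : \prod_x c x != 0 by apply/prodf_neq0.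
have jz := jac_neq0 (rep_birational (rep_red z)).
have [X EX] : divides (\prod_x c x) (jac (red z)).
  apply: (divides_primepow (@factorial_mpoly K 3) P0) => p [|n] pp pn.
    by exists (jac (red z)); rewrite expr0 mul1r.
  have [g0 gc] := gLR.
  (* A prime dividing two of the factors would be contracted by [z] to two orbit points, which
     genericity makes distinct. So one factor carries the whole power of [p]. *)
  have [|x px] := prime_power_prod pp (ltn0Sn n) _ pn.
    move=> x y px py; have [_ _ Hx] := Hc x; have [_ _ Hy] := Hc y.
    have [i Hi] := Hx p 1%N pp isT px; have [j Hj] := Hy p 1%N pp isT py.
    rewrite expr1 in Hi Hj.
    have := parallel_uniq (red_reduced z) pp (g0 _ _ _) (g0 _ _ _) Hi Hj.
    move=> /gc[]; case: x y {px py Hx Hy Hi Hj} => [b k] [b' k'] /= -> _ kk.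
    by congr (_, _); apply: val_inj.
  have [_ _ /(_ p n.+1 pp (ltn0Sn n) px)[i Hi]] := Hc x.
  exact: parallel_jac (g0 _ _ _) Hi.
have [_ zd] := red_hdeg z.
have Pd : \prod_x c x \is (\sum_x dg x)%N.-homog by apply: homog_prod_fin => x; case: (Hc x).
have jX : X * \prod_x c x = jac (red z) by rewrite mulrC.
have := @homog_cofactor _ _ X (\prod_x c x) _ _ _ _ Pd.
rewrite jX => /(_ _ jz (jac_homog zd))[+ _]; apply: leq_trans.
rewrite -(pair_bigA _ (fun b (k : 'I_N) => dg (b, k))) big_bool.
exact: leqnn.
Qed.

End Degrees.

(** The defect of step k is later multiplied by 2^(N-1-k), hence costs at most 2^(N-1) times itself.
    Both sides are doubled to avoid the exponent N - 1. *)
Lemma doubling_defect (a : nat -> nat) N : (forall k, (a k.+1 <= 2 * a k)%N) ->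
  (2 ^ N.+1 * a 0 <= 2 * a N + 2 ^ N * \sum_(k < N) (2 * a k - a k.+1))%N.
Proof.
move=> H; elim: N => [|N IHN]; first by rewrite big_ord0 muln0 addn0.
rewrite big_ord_recr /=; have := H N; move: IHN.
move: (\sum_(k < N) _)%N => S; rewrite !expnS.
have : (0 < 2 ^ N)%N by rewrite expn_gt0.
move: (2 ^ N)%N => P P0; move: (a N) (a N.+1) (a 0%N) => x y u; nia.
Qed.

(** Induction on the bound: past a nonzero term, the remaining sums obey a smaller one. *)
Lemma bounded_sum_vanish (c : nat -> nat) B :
  (forall N, (\sum_(k < N) c k <= B)%N) -> exists N, forall n, (N <= n)%N -> c n = 0%N.
Proof.
elim: B c => [|B IHB] c H.
  exists 0%N => n _; have := H n.+1; rewrite big_ord_recr /=; lia.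
have [H0|/existsNP[m cm]] := pselect (forall n, c n = 0%N); first by exists 0%N.
have [|N HN] := IHB (fun k => c (m.+1 + k)%N).
  move=> N; have := H (m.+1 + N)%N; rewrite big_split_ord /= big_ord_recr /=; lia.
exists (m.+1 + N)%N => n mn; have := HN (n - m.+1)%N.
by rewrite subnKC; [apply; lia|lia].
Qed.

Section Dynamics.
Variable K : numFieldType.
Implicit Types (z : Bir K).

Lemma bdeg_reduced z T d : rep z T -> reduced T -> hdeg T d -> bdeg z = d.
Proof.
move=> rT Tr Td; have [c c0 E] := rep_reduced rT Tr.
have h : hdeg T (0 + bdeg z).
  rewrite E; apply: hdeg_scale (red_hdeg z); first by rewrite mpolyC_eq0.
  by rewrite -[c%:MP]mulr1 mul_mpolyC; apply/dhomogZ/dhomog1.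
exact: hdeg_uniq h Td.
Qed.

Lemma hdeg_id : hdeg (triple_id K) 1.
Proof.
split; first by exists 0; rewrite tnth_mktuple mpolyX_eq0.
by move=> i; rewrite tnth_mktuple dhomogX /= mdeg1.
Qed.

Lemma bdeg1 : bdeg (1%g : Bir K) = 1%N.
Proof. exact: bdeg_reduced (rep1 K) (reduced_id K) hdeg_id. Qed.

Lemma bdeg_gt0 z : (0 < bdeg z)%N.
Proof.
rewrite lt0n; apply: contra (jac_neq0 (rep_birational (rep_red z))) => /eqP z0.
have [_] := red_hdeg z; rewrite z0 => T0; rewrite /jac det3 !mxE.
have D i j : (tnth (red z) i)^`M(j) = 0 by rewrite (homog0_const (T0 i)) mderivC.
by rewrite !D; apply/eqP; ring.
Qed.

Variables (f : Bir K) (L R : 'M[K]_3).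
Hypotheses (uL : L \in unitmx) (uR : R \in unitmx) (rf : rep f (quad L R)).
Hypothesis gLR : generic L R.

Lemma bdeg_le z k : (bdeg (f ^+ k.+1 * z)%g <= 2 * bdeg (f ^+ k * z)%g)%N.
Proof. by rewrite expgS -mulgA; have [C []] := quad_step rf (f ^+ k * z)%g. Qed.

Lemma bdeg_doubling z :
  exists N, forall n, (N <= n)%N -> bdeg (f ^+ n.+1 * z)%g = (2 * bdeg (f ^+ n * z)%g)%N.
Proof.
have [|N HN] := @bounded_sum_vanish
    (fun k => 2 * bdeg (f ^+ k * z)%g - bdeg (f ^+ k.+1 * z)%g)%N (3 * (bdeg z).-1).
  by move=> N; apply: leq_trans (degree_drop_bound z N uL uR rf gLR); apply: leq_addr.
by exists N => n /HN /eqP; rewrite subn_eq0 => h; apply/eqP; rewrite eqn_leq bdeg_le.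
Qed.

Lemma bdeg_doublingX z N :
  (forall n, (N <= n)%N -> bdeg (f ^+ n.+1 * z)%g = (2 * bdeg (f ^+ n * z)%g)%N) ->
  forall j, bdeg (f ^+ (N + j) * z)%g = (2 ^ j * bdeg (f ^+ N * z)%g)%N.
Proof.
move=> H; elim=> [|j IHj]; first by rewrite addn0 mul1n.
by rewrite addnS H ?leq_addr // IHj expnS mulnA.
Qed.

(** For the identity the bound on the total drop is 3 (1 - 1) = 0, so the powers of f lose no
    degree. *)
Lemma bdegX n : bdeg (f ^+ n)%g = (2 ^ n)%N.
Proof.
elim: n => [|n IHn]; first by rewrite expg0 bdeg1.
have := degree_drop_bound 1%g n.+1 uL uR rf gLR; rewrite bdeg1 big_ord_recr /=.
have := bdeg_le 1%g n; rewrite !mulg1 IHn expnS; lia.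
Qed.

End Dynamics.

(** Write d = deg z. Adding [doubling_defect] for f and f^-1 gives 4 d 2^N on the left, and the
    total drop costs at most 3 (d - 1) 2^N on the right; the difference is (d + 3) 2^N. *)
Lemma bdeg_spread (K : numFieldType) (f : Bir K) L R z N :
  L \in unitmx -> R \in unitmx -> rep f (quad L R) -> generic L R ->
  (2 ^ N * (bdeg z + 3) <= 2 * (bdeg (f ^+ N * z)%g + bdeg (f^-1 ^+ N * z)%g))%N.
Proof.
move=> uL uR rf gLR; have rV := rep_quadV uL uR rf.
have := degree_drop_bound z N uL uR rf gLR.
have := @doubling_defect (fun k => bdeg (f ^+ k * z)%g) N (bdeg_le rf z).
have := @doubling_defect (fun k => bdeg (f^-1 ^+ k * z)%g) N (bdeg_le rV z).
rewrite !expg0 !mul1g; move: (\sum_(k < N) _)%N (\sum_(k < N) _)%N => S S'.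
have := bdeg_gt0 z; move: (bdeg _) (bdeg _) (bdeg _) => x y u.
rewrite !expnS; move: (2 ^ N)%N => P; nia.
Qed.

(** * Totally invariant curves *)

Lemma prime_assoc (R : idomainType) (p u : R) :
  prime_elt p -> u \is a GRing.unit -> prime_elt (p * u).
Proof.
move=> [p0 pU pP] uu; split.
- by rewrite mulf_neq0 //; apply: contraTneq uu => ->; rewrite unitr0.
- by rewrite unitrM negb_and pU.
have dpu a : divides p a -> divides (p * u) a.
  by move=> [c ->]; exists (u^-1 * c); rewrite -mulrA mulVKr.
move=> a b [c E]; have /pP[] : divides p (a * b) by rewrite E -mulrA; exists (u * c).
  by left; apply: dpu.
by right; apply: dpu.
Qed.

(** The prime [p] has even multiplicity in a square; removing [p ^+ 2] repeatedly leaves a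
    square. *)
Lemma prime_square (R : idomainType) (p y t : R) e : prime_elt p -> ~ divides p y ->
  p ^+ e * y = t ^+ 2 -> exists e' t', e = (2 * e')%N /\ y = t' ^+ 2.
Proof.
move=> pp py; elim/ltn_ind: e t => -[|[|e]] IHe t E.
- by exists 0%N, t; rewrite -E expr0 mul1r.
- have [t' Et] : divides p t.
    by apply: (@prime_exp _ _ _ 2) => //; exists y; rewrite -E expr1.
  case: py; exists (t' ^+ 2); have [p0 _ _] := pp; apply: (mulfI p0).
  by rewrite -[p in LHS]expr1 E Et; ring.
have [t' Et] : divides p t.
  by apply: (@prime_exp _ _ _ 2) => //; exists (p ^+ e.+1 * y); rewrite -E exprS mulrA.
have lt_e : (e < e.+2)%N by lia.
have [|e' [t'' [Ee Ey]]] := IHe e lt_e t'.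
  have [p0 _ _] := pp; apply: (mulfI (expf_neq0 2 p0)).
  by rewrite mulrA -exprD E Et exprMn.
by exists e'.+1, t''; split => //; lia.
Qed.

Section LinearForms.
Variable K : fieldType.

Lemma linear_prime n (p : {mpoly K[n]}) : p != 0 -> p \is 1.-homog -> prime_elt p.
Proof.
move=> p0 p1; have [|q qp [c Ec]] := exists_prime_divisor p0.
  by apply/negP => /homog_unit/(_ p1).
move: p0 p1; rewrite Ec => p0 p1; have [d qd d1] := homog_factor p0 p1.
have d0 := prime_homog_gt0 qp qd; have Ed : d = 1%N by lia.
rewrite Ed in qd; rewrite mulrC in p0 p1; have [_ c0] := homog_cofactor p0 p1 qd.
rewrite subnn in c0; apply: prime_assoc => //; apply: homog0_unit c0.
by move: p0; rewrite mulf_eq0 negb_or => /andP[].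
Qed.

End LinearForms.

Section InvariantCurves.
Variable K : numFieldType.
Implicit Types (L R : 'M[K]_3) (T : triple K) (C : {mpoly K[3]}).

Lemma linear_form_homog L i : tnth (linear_triple L) i \is 1.-homog.
Proof.
rewrite -[linear_triple L]triple_comp1; apply: linear_homog => j.
by rewrite tnth_mktuple dhomogX /= mdeg1.
Qed.

Lemma linear_form_eval L M i j :
  (tnth (linear_triple L) i).@[fun k => (M *m base_vec K j) k 0] = (L *m M) i j.
Proof.
have -> : (L *m M) i j = (L *m (M *m base_vec K j)) i 0.
  by rewrite /base_vec mulmxA -colE [RHS]mxE.
rewrite tnth_mktuple rmorph_sum mxE; apply: eq_bigr => k _ /=.
by rewrite mevalZ mevalXU.
Qed.

Lemma linear_form_neq0 L i : L \in unitmx -> tnth (linear_triple L) i != 0.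
Proof.
move=> uL; apply/eqP => /(congr1 (meval (fun k => (invmx L *m base_vec K i) k 0))).
by rewrite linear_form_eval mulmxV // meval0 mxE eqxx => /eqP; rewrite oner_eq0.
Qed.

Lemma linear_form_prime L i : L \in unitmx -> prime_elt (tnth (linear_triple L) i).
Proof. by move=> uL; apply: linear_prime (linear_form_neq0 i uL) (linear_form_homog L i). Qed.

Lemma sigma_comp2 T : triple_comp (sigma_triple K) (triple_comp (sigma_triple K) T)
  = scale_triple (tnth T 0 * tnth T 1 * tnth T 2%:R) T.
Proof.
apply: eq_from_tnth => i; rewrite sigma_comp !sigma_comp tnth_mktuple /=.
by have [->|->|->] := ord3P i; rewrite /=; ring.
Qed.

Lemma quad_quadV L R : L \in unitmx -> R \in unitmx ->
  triple_comp (quad L R) (quad (invmx R) (invmx L))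
  = scale_triple (tnth (linear_triple (invmx L)) 0 * tnth (linear_triple (invmx L)) 1
                  * tnth (linear_triple (invmx L)) 2%:R) (triple_id K).
Proof.
move=> uL uR; have uL' : invmx L \in unitmx by rewrite unitmx_inv.
rewrite quad_comp /quad (triple_compA (linear_triple R)) -linear_tripleM mulmxV //.
rewrite linear_triple1 triple_1comp sigma_comp2.
have -> T C : triple_comp (linear_triple L) (scale_triple C T)
    = scale_triple C (triple_comp (linear_triple L) T).
  by rewrite (comp_scale_triple _ _ (linear_form_homog L)) expr1.
by rewrite -linear_tripleM mulmxV // linear_triple1.
Qed.

Variables (f : Bir K) (L R : 'M[K]_3).
Hypotheses (uL : L \in unitmx) (uR : R \in unitmx) (rf : rep f (quad L R)).
Hypothesis gLR : generic L R.

Let red_iter n : exists2 c, c != 0 &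
  triple_comp (quad L R) (red (f ^+ n)%g) = scale_triple c%:MP (red (f ^+ n.+1)%g).
Proof.
have [C [C0 Ch _ E]] := quad_step rf (f ^+ n)%g.
move: Ch; rewrite -expgS !(bdegX uL uR rf gLR) -expnS subnn => /(homog0_unit C0).
by case/mpoly_unitP => c c0 Ec; exists c; rewrite // E Ec expgS.
Qed.

Lemma invariant_iter C k : k != 0 -> C != 0 -> (exists e, C \is e.-homog) ->
  C \mPo quad L R = k *: C ^+ 2 ->
  forall n, exists2 c, c != 0 & C \mPo red (f ^+ n)%g = c *: C ^+ (2 ^ n).
Proof.
move=> k0 C0 [e Ce] E; elim=> [|n [c c0 En]].
  have [c c0 Ec] := rep_reduced (rep1 K) (reduced_id K).
  exists (c^-1 ^+ e); first by rewrite expf_neq0 // invr_eq0.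
  have : C \mPo triple_id K = C by apply: comp_mpoly_id.
  rewrite {1}Ec (comp_scale _ _ Ce) expg0 expn0 expr1 => H; rewrite -[in RHS]H.
  by rewrite -mul_mpolyC mulrA -rmorphXn -rmorphM -exprMn mulVf // expr1n mul1r.
have [d d0 Ed] := red_iter n.
have H : d%:MP ^+ e * (C \mPo red (f ^+ n.+1)%g) = k *: (c *: C ^+ (2 ^ n)) ^+ 2.
  rewrite -(comp_scale _ _ Ce) -/(scale_triple _ _) -Ed comp_comp E.
  by rewrite comp_mpolyZ rmorphXn /= En.
exists (d^-1 ^+ e * k * c ^+ 2); first by rewrite !mulf_neq0 ?expf_neq0 ?invr_eq0.
have -> : C \mPo red (f ^+ n.+1)%g
    = (d^-1 ^+ e)%:MP * (d%:MP ^+ e * (C \mPo red (f ^+ n.+1)%g)).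
  by rewrite mulrA -rmorphXn -rmorphM -exprMn mulVf // expr1n mul1r.
by rewrite H -!mul_mpolyC expnS mulnC exprM !rmorphM !rmorphXn /=; ring.
Qed.

(** The curve [p = 0] is contracted by f^(s+1) to L e_i, hence by f^(t+1) to f^(t-s)(L e_i). But
    f^(t+1) also contracts it to L e_i, against genericity. *)
Lemma contracted_disjoint p i s t : prime_elt p -> (s < t)%N ->
  divides p (tnth (triple_comp (linear_triple R) (red (f ^+ s)%g)) i) ->
  divides p (tnth (triple_comp (linear_triple R) (red (f ^+ t)%g)) i) -> False.
Proof.
move=> pp st ps pt; have [g0 gc] := gLR.
have image n : divides p (tnth (triple_comp (linear_triple R) (red (f ^+ n)%g)) i) ->
    parallel (p ^+ 1) (red (f ^+ n.+1)%g) (orbit_point L R false i 0).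
  move=> /(quad_contracts L); have [c c0 ->] := red_iter n.
  rewrite expr1 /orbit_point /base_point /= invmxK => H a b.
  move: (H a b); rewrite !tnth_mktuple !scalerAr -mulrBr.
  by apply: divides_unitl; apply: mpolyC_unit.
have Ps := image _ ps; have := image _ pt; rewrite expr1 => Pt.
have := @parallel_iter _ _ _ _ rf (f ^+ s.+1)%g p 1 _ (t - s) pp isT _ Ps.
rewrite expr1 -expgnDr; have -> : (t - s + s.+1 = t.+1)%N by lia.
have E j : iter j (teval (quad L R)) (orbit_point L R false i 0) = orbit_point L R false i j.
  by rewrite /orbit_point !base_pointE /= !invmxK.
rewrite E => H; have {}H : parallel p (red (f ^+ t.+1)%g) (orbit_point L R false i (t - s)).
  by apply: H => j _; rewrite E.
have := parallel_uniq (red_reduced _) pp (g0 _ _ _) (g0 _ _ _) Pt H.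
move=> /gc[_ _]; lia.
Qed.

(** If [C] vanished at L e_i, the line contracted to this point would divide C(f), hence C^2, and
    the prime factors of its pullbacks under all f^n would divide [C]. By [contracted_disjoint]
    different n give different primes, while [C] has finitely many. *)
Lemma invariant_no_contracted C k e i : k != 0 -> C != 0 -> C \is e.-homog ->
  C \mPo quad L R = k *: C ^+ 2 -> C.@[fun j => (L *m base_vec K i) j 0] != 0.
Proof.
move=> k0 C0 Ce E; apply/eqP => Cw; have [g0 _] := gLR.
have rC : divides (tnth (linear_triple R) i) (C ^+ 2).
  have par : parallel (tnth (linear_triple R) i) (quad L R) (L *m base_vec K i).
    rewrite -[quad L R]triple_comp1; apply: quad_contracts.
    by rewrite triple_comp1; apply: divides_refl.
  have w0 : L *m base_vec K i != 0.
    by have := g0 false i 0%N; rewrite /orbit_point /base_point /= invmxK.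
  have [j wj] := nz_coord w0.
  have := cong_homog Ce (parallel_cong wj par).
  rewrite Cw mpolyC0 mulr0 /cong subr0 E -mul_mpolyC.
  by apply: divides_unitl; apply: mpolyC_unit.
pose r n := tnth (triple_comp (linear_triple R) (red (f ^+ n)%g)) i.
have r_prime n : exists2 p, prime_elt p & divides p (r n).
  have r0 : r n != 0.
    rewrite /r tnth_comp; apply: contra_neq (linear_form_neq0 i uR).
    exact: bir_dominant (rep_birational (rep_red _)) (linear_form_homog R i).
  apply: exists_prime_divisor => //; apply/negP => rU.
  have /(homog_unit rU) : r n \is (bdeg (f ^+ n)%g).-homog.
    by apply: linear_homog; case: (red_hdeg (f ^+ n)%g).
  by rewrite (bdegX uL uR rf gLR) => /eqP; rewrite expn_eq0.
have pC n p : prime_elt p -> divides p (r n) -> divides p C.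
  move=> pp pr; have [c c0 En] := invariant_iter k0 C0 (ex_intro _ e Ce) E n.
  case: rC => a Ea; have := congr1 (comp_mpoly (red (f ^+ n)%g)) Ea.
  rewrite rmorphXn rmorphM /= En -tnth_comp -/(r n) => Er.
  have : divides p ((c%:MP * C ^+ (2 ^ n)) ^+ 2).
    by rewrite mul_mpolyC Er; apply: divides_mulr.
  move=> /(prime_exp pp) /divides_unitl - /(_ (mpolyC_unit _ c0)).
  exact: prime_exp.
have [s Cs] := factorial_mpoly C0.
have /choice[q Hq] : forall n, exists q, q \in s /\ exists p,
    [/\ prime_elt p, divides p (r n) & exists2 u, u \is a GRing.unit & q = u * p].
  move=> n; have [p pp pr] := r_prime n.
  have [q qs [u uu Eq]] := factorization_divides pp Cs (pC _ _ pp pr).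
  by exists q; split=> //; exists p; split=> //; exists u.
(* Pigeonhole: the factors chosen for [(size s).+1] exponents are pairwise distinct members of
   [s]. *)
suff : (size (map q (iota 0 (size s).+1)) <= size s)%N by rewrite size_map size_iota ltnn.
apply: uniq_leq_size; last by move=> _ /mapP[n _ ->]; case: (Hq n).
rewrite map_inj_in_uniq ?iota_uniq // => a b _ _ qab.
have [_ [p [pp pa [u uu Ep]]]] := Hq a; have [_ [p' [pp' pb [u' uu' Ep']]]] := Hq b.
have pb' : divides p (r b).
  apply: divides_trans pb; apply: (divides_unitl uu').
  by rewrite -Ep' -qab Ep; apply/divides_mull/divides_refl.
case: (ltngtP a b) => // [ab|ba].
  by case: (contracted_disjoint pp ab pa pb').
by case: (contracted_disjoint pp ba pb' pa).
Qed.

(* A curve with f^-1(C) = 2C would be a square, by counting multiplicities along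
   the lines contracted by f^-1; this allows infinite descent on the degree. *)
Lemma invariant_const C k e : k != 0 -> C != 0 -> C \is e.-homog ->
  C \mPo quad L R = k *: C ^+ 2 -> e = 0%N.
Proof.
elim/ltn_ind: e C k => e IHe C k k0 C0 Ce E.
have Cw i := invariant_no_contracted i k0 C0 Ce E.
pose m i := tnth (linear_triple (invmx L)) i.
have uL' : invmx L \in unitmx by rewrite unitmx_inv.
have mp i : prime_elt (m i) by apply: linear_form_prime.
have mw i j : (m i).@[fun l => (L *m base_vec K j) l 0] = (i == j)%:R.
  by rewrite linear_form_eval mulVmx // mxE.
(* The line [m i] passes through the points L e_j with j different from i, where [C] does not
   vanish. *)
have mC i : ~ divides (m i) C.
  move=> [c Ec]; have [j ji] : exists j, i != j by exists (i + 1); case: i {Ec} => -[|[|[|]]].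
  have := Cw j; rewrite Ec rmorphM /= mw (negPf ji) mul0r eqxx.
  by [].
have mm i j : i != j -> ~ divides (m i) (m j).
  move=> ij [c Ec]; have := mw j j; rewrite Ec rmorphM /= mw (negPf ij) mul0r eqxx.
  by move=> /eqP; rewrite eq_sym oner_eq0.
have mM i a b : ~ divides (m i) a -> ~ divides (m i) b -> ~ divides (m i) (a * b).
  by move=> ia ib; case: (mp i) => _ _ h /h[].
have mX i j : i != j -> ~ divides (m i) (m j ^+ e).
  by move=> /mm ij /(prime_exp (mp i)).
pose T := C \mPo quad (invmx R) (invmx L).
(* Substitute f^-1 in the equation of [C]: f after f^-1 is the identity scaled by the product of the
   three lines, which comes out to the power [e]. Each line thus has multiplicity exactly [e] in a
   square. *)
have ET : (m 0) ^+ e * ((m 1) ^+ e * ((m 2%:R) ^+ e * C)) = k *: T ^+ 2.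
  rewrite /T -rmorphXn /= -comp_mpolyZ -E -comp_comp quad_quadV //.
  rewrite (comp_scale _ _ Ce) comp_mpoly_id -/(m 0) -/(m 1) -/(m 2%:R) !exprMn; ring.
have kU := mpolyC_unit 3 k0; pose k' := (k^-1)%:MP_[3].
have kk : k' * k%:MP = 1 by rewrite -rmorphM mulVf.
have mk i a : ~ divides (m i) a -> ~ divides (m i) (k' * a).
  by move=> ia /divides_unitl - /(_ (mpolyC_unit _ (invr_neq0 k0))).
have [e' [S [Ee ES]]] : exists e' S, e = (2 * e')%N /\ k' * C = S ^+ 2.
  have E0 : (m 0) ^+ e * ((m 1) ^+ e * ((m 2%:R) ^+ e * (k' * C))) = T ^+ 2.
    transitivity (k' * (k *: T ^+ 2)); first by rewrite -ET; ring.
    by rewrite -mul_mpolyC mulrA kk mul1r.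
  have [||e' [T1 [Ee E1]]] := prime_square _ _ E0; first exact: mp.
    by do 2![apply: (mM); first exact: mX]; apply: mk.
  have [||_ [T2 [_ E2]]] := prime_square _ _ E1; first exact: mp.
    by apply: mM; [exact: mX|exact: mk].
  have [||_ [T3 [_ E3]]] := prime_square _ _ E2; [exact: mp|exact: mk|].
  by exists e', T3.
have EC : C = k *: S ^+ 2 by rewrite -ES -mul_mpolyC mulrA [k%:MP * _]mulrC kk mul1r.
have S0 : S != 0 by apply: contraNneq C0 => S0; rewrite EC S0 expr0n scaler0.
have [d Sd de] : exists2 d, S \is d.-homog & (d <= e)%N.
  by apply: (@homog_factor _ _ S (k *: S)); rewrite -scalerAr -expr2 -EC.
have Ed : e = (2 * d)%N.
  apply: dhomog_uniq C0 Ce _; rewrite EC; apply: dhomogZ; rewrite mulnC; exact: dhomogMn.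
(* The square root [S] satisfies the equation of [C] up to a sign, with constant k or -k; the
   descent continues with either. *)
have : (S \mPo quad L R) ^+ 2 = (k *: S ^+ 2) ^+ 2.
  have := E; rewrite {1}EC comp_mpolyZ rmorphXn /= -{1}EC => /scalerI - /(_ k0) ->.
  by rewrite EC.
move/eqP; rewrite eqf_sqr => SE; have [e0|e0] := eqVneq e 0%N; first by [].
have de' : (d < e)%N by move: Ed e0; clear; lia.
suff : d = 0%N by rewrite Ed => ->.
case/orP: SE => /eqP SE; first exact: IHe de' _ _ k0 S0 Sd SE.
by apply: (IHe d de' S (- k)) => //; rewrite ?oppr_eq0 // SE scaleNr.
Qed.

End InvariantCurves.

(** * The centralizer up to linear maps *)

Section Centralizer.
Variable K : numFieldType.
Implicit Types (z w g : Bir K).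

Section OneSide.
Variables (f : Bir K) (L R : 'M[K]_3).
Hypotheses (uL : L \in unitmx) (uR : R \in unitmx) (rf : rep f (quad L R)).
Hypothesis gLR : generic L R.

Lemma stable_commute z : commute f z -> bdeg (f * z)%g = (2 * bdeg z)%N ->
  exists2 c, c != 0 & triple_comp (red z) (quad L R)
    = scale_triple c%:MP_[3] (triple_comp (quad L R) (red z)).
Proof.
move=> fz dz; have h1 := comp_hdeg z rf (quad_hdeg rf).
rewrite -dz in h1; have [a a0 Ea] := rep_hdeg_eq (repM rf (rep_red z)) h1.
have h2 : hdeg (triple_comp (red z) (quad L R)) (bdeg (z * f)%g).
  rewrite -fz dz mulnC; have [_ zd] := red_hdeg z; have [_ qd] := quad_hdeg rf.
  have [nz _] := rep_ratmap (repM (rep_red z) rf); split=> [|i]; first exact: nz.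
  by rewrite tnth_comp; apply: comp_homog (zd i) qd.
have [b b0 Eb] := rep_hdeg_eq (repM (rep_red z) rf) h2.
exists (b * a^-1); first by rewrite mulf_neq0 ?invr_eq0.
rewrite Eb Ea -fz scale_tripleA; congr (scale_triple _ _).
by rewrite -rmorphM -mulrA mulVf // mulr1.
Qed.

Lemma bdegM_stable z w n : commute f z -> commute f w ->
  bdeg (f * z)%g = (2 * bdeg z)%N -> bdeg (f * w)%g = (2 * bdeg w)%N ->
  (z * w = f ^+ n)%g -> (bdeg z * bdeg w = 2 ^ n)%N.
Proof.
move=> fz fw dz dw zw; have fX m := bdegX uL uR rf gLR m.
have [c c0 Ec] := stable_commute fz dz; have [d d0 Ed] := stable_commute fw dw.
have [|k k0 Ek] := @stable_commute (f ^+ n)%g (commuteX n (commute_refl f)).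
  by rewrite -expgS !fX expnS.
have rzw := repM (rep_red z) (rep_red w); rewrite zw in rzw.
have [C [C0 Ch le E]] := rep_hdeg rzw (comp_hdeg w (rep_red z) (red_hdeg z)).
rewrite fX in Ch le.
have [_ zd] := red_hdeg z.
(* Two evaluations of the composite with f on the right are compared. Moving f leftwards across both
   factors lets it act on the common factor by squaring; substituting it directly gives C(f). *)
have EL : triple_comp (triple_comp (red z) (red w)) (quad L R)
    = scale_triple (d%:MP ^+ bdeg z * c%:MP * C ^+ 2)
        (triple_comp (quad L R) (red (f ^+ n)%g)).
  rewrite -triple_compA Ed (comp_scale_triple _ _ zd) triple_compA Ec.
  rewrite scale_triple_comp comp_mpolyC -triple_compA E.
  rewrite (comp_scale_triple C (red (f ^+ n)%g) (quad_homog L R)).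
  rewrite (scale_tripleA _ c%:MP) (scale_tripleA _ (C ^+ 2)); exact: erefl.
rewrite E scale_triple_comp Ek scale_tripleA in EL.
have /(scale_tripleI (rep_ratmap (repM rf (rep_red _)))) {}EL := EL.
have EC : C \mPo quad L R = (k^-1 * d ^+ bdeg z * c) *: C ^+ 2.
  have -> : C \mPo quad L R = (k^-1)%:MP * ((C \mPo quad L R) * k%:MP).
    by rewrite mulrCA -rmorphM mulVf // mulr1.
  have Ed' : d%:MP_[3] ^+ bdeg z = (d ^+ bdeg z)%:MP by rewrite rmorphXn.
  by rewrite EL Ed' expr2 -mul_mpolyC !mulrA -!mpolyCM.
have := invariant_const uL uR rf gLR _ C0 Ch EC.
rewrite !mulf_neq0 ?expf_neq0 ?invr_eq0 // => /(_ isT); lia.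
Qed.

(** The degrees of f^M g and f^M g^-1 have product 2^(2 M), so each is a power of 2. Quantifying
    over all large [M] lets f and f^-1 share a threshold; [a] includes the shift by [M], which keeps
    exponents natural. *)
Lemma bdeg_pow2 g : commute f g -> exists N, forall M, (N <= M)%N ->
  exists2 a, (a <= 2 * M)%N &
    (forall j, bdeg (f ^+ (M + j) * g)%g = 2 ^ (a + j))%N /\
    (forall j, bdeg (f ^+ (M + j) * g^-1)%g = 2 ^ (2 * M - a + j))%N.
Proof.
move=> fg; have [N1 H1] := bdeg_doubling uL uR rf gLR g.
have [N2 H2] := bdeg_doubling uL uR rf gLR g^-1%g.
exists (maxn N1 N2) => M; rewrite geq_max => /andP[M1 M2].
have {}H1 n : (M <= n)%N -> _ := fun h => H1 n (leq_trans M1 h).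
have {}H2 n : (M <= n)%N -> _ := fun h => H2 n (leq_trans M2 h).
have fM : commute f (f ^+ M)%g := commuteX M (commute_refl f).
have zw : (bdeg (f ^+ M * g)%g * bdeg (f ^+ M * g^-1)%g = 2 ^ (2 * M))%N.
  apply: bdegM_stable.
  - exact: commuteM.
  - by apply: commuteM => //; apply: commuteV.
  - by rewrite mulgA -expgS H1.
  - by rewrite mulgA -expgS H2.
  have gM : (g * f ^+ M = f ^+ M * g)%g by apply/esym/commute_sym/commuteX/commute_sym.
  by rewrite -mulgA (mulgA g) gM -mulgA mulgV mulg1 -expgnDr mul2n addnn.
have /(dvdn_pfactor _ _ (isT : prime 2))[a aM Ea] : (bdeg (f ^+ M * g)%g %| 2 ^ (2 * M))%N.
  by rewrite -zw dvdn_mulr.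
exists a => //.
have Eb : bdeg (f ^+ M * g^-1)%g = (2 ^ (2 * M - a))%N.
  have := zw; rewrite Ea -{1}(subnKC aM) expnD => /eqP.
  by rewrite eqn_pmul2l ?expn_gt0 // => /eqP.
split=> j; [rewrite (bdeg_doublingX H1) Ea|rewrite (bdeg_doublingX H2) Eb];
by rewrite -expnD addnC.
Qed.

End OneSide.

(** The map [w] is f^(N-a) z, written with natural exponents. At distance 2 N + a, its two iterates
    are f^(3N) z and f^-(N+2a) z, both in the range of known degrees. With P = 2^(2N+a) these
    degrees are P and at most P, so P (deg w + 3) <= 4 P. *)
Lemma linear_translate f L R N a b z : L \in unitmx -> R \in unitmx ->
  rep f (quad L R) -> generic L R -> (a + b <= 2 * N)%N ->
  (forall j, bdeg (f ^+ (N + j) * z)%g = 2 ^ (a + j))%N ->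
  (forall j, bdeg (f^-1 ^+ (N + j) * z)%g = 2 ^ (b + j))%N ->
  bdeg (f ^+ N * (f^-1 ^+ a * z))%g = 1%N.
Proof.
move=> uL uR rf gLR ab Ha Hb; set w := (f ^+ N * _)%g.
have Ep : (f ^+ (2 * N + a) * w = f ^+ (N + 2 * N) * z)%g.
  rewrite /w mulgA -expgnDr; have -> : (2 * N + a + N = N + 2 * N + a)%N by lia.
  by rewrite expgnDr -mulgA expVgn mulVKg.
have Em : (f^-1 ^+ (2 * N + a) * w = f^-1 ^+ (N + 2 * a) * z)%g.
  rewrite /w; have -> : (2 * N + a = N + a + N)%N by lia.
  rewrite expgnDr -mulgA (expVgn f N) mulKg mulgA -expgnDr.
  by congr (_ ^+ _ * _)%g; lia.
have := bdeg_spread w (2 * N + a) uL uR rf gLR.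
rewrite Ep Em Ha Hb [(a + 2 * N)%N]addnC.
have : (2 ^ (b + 2 * a) <= 2 ^ (2 * N + a))%N by rewrite leq_exp2l //; lia.
have := bdeg_gt0 w; have : (0 < 2 ^ (2 * N + a))%N by rewrite expn_gt0.
move: (2 ^ (2 * N + a))%N (2 ^ (b + 2 * a))%N (bdeg w) => P Q e; nia.
Qed.

Theorem centralizer_linear f L R g : L \in unitmx -> R \in unitmx ->
  rep f (quad L R) -> generic L R -> commute f g ->
  exists N a, bdeg (f ^+ N * (f^-1 ^+ a * g))%g = 1%N \/
              bdeg (f ^+ N * (f^-1 ^+ a * g^-1))%g = 1%N.
Proof.
move=> uL uR rf gLR fg; have rV := rep_quadV uL uR rf; have gV := generic_inv gLR.
have [uL' uR'] : invmx L \in unitmx /\ invmx R \in unitmx by rewrite !unitmx_inv.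
have [N1 H1] := bdeg_pow2 uL uR rf gLR fg.
have fVg : commute f^-1%g g by apply/commute_sym/commuteV/commute_sym.
have [N2 H2] := bdeg_pow2 uR' uL' rV gV fVg.
pose N := maxn N1 N2.
have [a aN [Ha Ha']] := H1 N (leq_maxl _ _).
have [b bN [Hb Hb']] := H2 N (leq_maxr _ _).
have [ab|ab] := leqP (a + b) (2 * N).
  by exists N, a; left; apply: linear_translate uL uR rf gLR ab Ha Hb.
(* Passing to [g^-1] replaces a and b by 2 N - a and 2 N - b, whose sum 4 N - (a + b) is now below 2
   N. *)
exists N, (2 * N - a)%N; right.
have ab' : (2 * N - a + (2 * N - b) <= 2 * N)%N by lia.
exact: linear_translate uL uR rf gLR ab' Ha' Hb'.
Qed.

End Centralizer.

(** * Genericity *)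

Section SigmaIter.
Variable A : comNzRingType.

(** The orbit of M e_i under M sigma, over any commutative ring so that it can be formed with
    indeterminate entries and then specialized. *)
Definition sigma_orbit (M : 'M[A]_3) i k : 'cV[A]_3 :=
  iter k (fun v => M *m sigma_vec v) (M *m delta_mx i 0).

Lemma sig_scale (c : A) v : sigma_vec (c *: v) = c ^+ 2 *: sigma_vec v.
Proof. by apply/colP => i; rewrite !mxE; case: ifP => _; [|case: ifP => _]; ring. Qed.

Lemma sig_sig (v : 'cV[A]_3) : sigma_vec (sigma_vec v) = (v 0 0 * v 1 0 * v 2%:R 0) *: v.
Proof. by apply/colP => i; rewrite !mxE /=; have [->|->|->] := ord3P i; rewrite /=; ring. Qed.

End SigmaIter.

Lemma map_sig (A B : comNzRingType) (h : {rmorphism A -> B}) (v : 'cV[A]_3) :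
  map_mx h (sigma_vec v) = sigma_vec (map_mx h v).
Proof.
by apply/colP => i; rewrite !mxE; case: ifP => _; [|case: ifP => _]; rewrite rmorphM.
Qed.

Lemma map_sigma_orbit (A B : comNzRingType) (h : {rmorphism A -> B}) (M : 'M[A]_3) i k :
  map_mx h (sigma_orbit M i k) = sigma_orbit (map_mx h M) i k.
Proof.
elim: k => [|k IHk]; first by rewrite /sigma_orbit /= map_mxM map_delta_mx.
by rewrite /sigma_orbit !iterS map_mxM map_sig -/(sigma_orbit _ _ _) IHk.
Qed.

(** Neither sigma nor the matrix product involves a subtraction. Positive matrices therefore witness
    that the coordinates are nonzero polynomials in the entries. *)
Lemma sigma_orbit_gt0 (F : numDomainType) (M : 'M[F]_3) i k l :
  (forall a b, 0 < M a b) -> 0 < sigma_orbit M i k l 0.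
Proof.
move=> M0; elim: k l => [|k IHk] l.
  by rewrite /sigma_orbit /= -colE mxE.
rewrite /sigma_orbit iterS mxE big_ord3 -/(sigma_orbit _ _ _).
have s0 j : 0 < sigma_vec (sigma_orbit M i k) j 0.
  by rewrite mxE; case: ifP => _; [|case: ifP => _]; rewrite mulr_gt0.
by rewrite /= !addr_gt0 ?mulr_gt0.
Qed.

(** * Nonvanishing of orbit coordinates by rational specialization *)

Section AlgIndependent.
Variables (K : numFieldType) (M : 'M[K]_3).
Hypothesis Mind : alg_independent_over_Q (fun k => mxvec M 0 k).

Definition generic_mx : 'M[{mpoly rat[3 * 3]}]_3 := \matrix_(i, j) 'X_(mxvec_index i j).

Lemma generic_mx_spec (S : comNzRingType) (h : {rmorphism rat -> S}) (N : 'M[S]_3) :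
  map_mx (mmap h (fun k => mxvec N 0 k)) generic_mx = N.
Proof. by apply/matrixP => i j; rewrite !mxE mmapX mmap1U mxvecE. Qed.

Lemma specialize_neq0 (p : {mpoly rat[3 * 3]}) (N : 'M[rat]_3) :
  mmap idfun (fun k => mxvec N 0 k) p != 0 -> mmap ratr (fun k => mxvec M 0 k) p != 0.
Proof. by apply: contra_neq => /Mind ->; rewrite mmap0. Qed.

Lemma alg_independent_orbit (X : 'M[{mpoly rat[3 * 3]}]_3) (N : 'M[rat]_3) i k l :
  (forall a b, 0 < map_mx (mmap idfun (fun k => mxvec N 0 k)) X a b) ->
  sigma_orbit (map_mx (mmap ratr (fun k => mxvec M 0 k)) X) i k l 0 != 0.
Proof.
move=> N0; rewrite -map_sigma_orbit mxE; apply: (@specialize_neq0 _ N).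
have := sigma_orbit_gt0 i k l N0; rewrite -map_sigma_orbit mxE.
exact: lt0r_neq0.
Qed.

Lemma orbit_coord_neq0 i k l : sigma_orbit M i k l 0 != 0.
Proof.
have := @alg_independent_orbit generic_mx (const_mx 1) i k l.
rewrite !generic_mx_spec; apply => a b; by rewrite mxE ltr01.
Qed.

Lemma adj_orbit_coord_neq0 i k l : sigma_orbit (\adj M) i k l 0 != 0.
Proof.
(* The adjugate is used since it is polynomial in the entries. A specialization with positive
   adjugate is wanted: [B] is positive and invertible, of determinant 4, so the adjugate of its
   inverse is B / 4. *)
pose B : 'M[rat]_3 := 1%:M + const_mx 1.
have dB : \det B = 4 by rewrite det3 !mxE /=; ring.
have uB : B \in unitmx by rewrite unitmxE dB.
have := @alg_independent_orbit (\adj generic_mx) (invmx B) i k l.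
rewrite !map_mx_adj !generic_mx_spec; apply => a b.
have -> : \adj (invmx B) = \det (invmx B) *: B.
  have uA : invmx B \in unitmx by rewrite unitmx_inv.
  have E : (\det (invmx B))^-1 *: \adj (invmx B) = B by rewrite -[RHS]invmxK [RHS]/invmx uA.
  move: uA E; rewrite unitmxE unitfE; move: (invmx B) => A dA <-.
  by rewrite scalerA mulfV // scale1r.
rewrite mxE det_inv dB mulr_gt0 ?invr_gt0 // !mxE.
by rewrite ltr_wpDl ?ler0n.
Qed.

Lemma alg_independent_det : \det M != 0.
Proof.
have := @specialize_neq0 (\det generic_mx) 1%:M.
by rewrite -!det_map_mx !generic_mx_spec det1 oner_neq0 => /(_ isT).
Qed.

Lemma alg_independent_unit : M \in unitmx.
Proof. by rewrite unitmxE unitfE alg_independent_det. Qed.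

Lemma inv_orbit_coord_neq0 i k l : sigma_orbit (invmx M) i k l 0 != 0.
Proof.
suff [c c0 ->] : exists2 c, c != 0 &
    sigma_orbit (invmx M) i k = c *: sigma_orbit (\adj M) i k.
  by rewrite mxE mulf_neq0 // adj_orbit_coord_neq0.
rewrite /invmx alg_independent_unit; have d0 : (\det M)^-1 != 0.
  by rewrite invr_eq0 alg_independent_det.
elim: k => [|k [c c0 E]]; first by exists (\det M)^-1; rewrite // /sigma_orbit /= -scalemxAl.
exists ((\det M)^-1 * c ^+ 2); first by rewrite mulf_neq0 ?expf_neq0.
rewrite /sigma_orbit !iterS -!/(sigma_orbit _ _ _) E sig_scale.
by rewrite -scalemxAl -scalemxAr scalerA.
Qed.

End AlgIndependent.

Section Collinear.
Variable K : numFieldType.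
Implicit Types (u v w : 'cV[K]_3).

Definition full v : Prop := forall i, v i 0 != 0.

Lemma full_neq0 v : full v -> v != 0.
Proof. by move=> /(_ 0); apply: contraNneq => ->; rewrite mxE. Qed.

Lemma full_sig v : full v -> full (sigma_vec v).
Proof. by move=> fv i; rewrite mxE; case: ifP => _; [|case: ifP => _]; rewrite mulf_neq0. Qed.

Lemma base_vec_neq0 i : base_vec K i != 0.
Proof. by apply/eqP => /colP /(_ i); rewrite !mxE !eqxx => /eqP; rewrite oner_eq0. Qed.

Lemma collinearP v w : v != 0 -> w != 0 -> collinear v w ->
  exists2 c, c != 0 & v = c *: w.
Proof.
move=> v0 /nz_coord[j wj] vw; exists (v j 0 / w j 0).
  apply: contraNneq v0 => /eqP; rewrite mulf_eq0 invr_eq0 (negPf wj) orbF => /eqP vj.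
  apply/eqP/colP => i; rewrite mxE; apply: (mulIf wj).
  by rewrite vw vj !mul0r.
by apply/colP => i; rewrite mxE; apply: (mulIf wj); rewrite vw mulrAC mulfVK.
Qed.

Lemma collinear_sym v w : collinear v w -> collinear w v.
Proof. by move=> vw i j; rewrite mulrC -vw mulrC. Qed.

Lemma scale_collinear c d v w : c != 0 -> d != 0 ->
  collinear (c *: v) (d *: w) -> collinear v w.
Proof.
move=> c0 d0 H i j; apply: (mulfI (mulf_neq0 c0 d0)).
by have := H i j; rewrite !mxE => E; rewrite -!mulrA !(mulrCA d) !mulrA in E *.
Qed.

Lemma collinear_scale c d v : collinear (c *: v) (d *: v).
Proof. by move=> i j; rewrite !mxE; ring. Qed.

Lemma collinear_sig v w : v != 0 -> w != 0 ->
  collinear v w -> collinear (sigma_vec v) (sigma_vec w).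
Proof.
move=> v0 w0 /(collinearP v0 w0)[c c0 ->]; rewrite sig_scale -[X in collinear _ X]scale1r.
exact: collinear_scale.
Qed.

Lemma collinear_mx (M : 'M[K]_3) v w : v != 0 -> w != 0 ->
  collinear v w -> collinear (M *m v) (M *m w).
Proof.
move=> v0 w0 /(collinearP v0 w0)[c c0 ->]; rewrite -scalemxAr -[X in collinear _ X]scale1r.
exact: collinear_scale.
Qed.

Lemma base_vec_full i v : full v -> ~ collinear (base_vec K i) v.
Proof.
move=> fv; have [j ji] : exists j, j != i by exists (i + 1); case: i => -[|[|[|]]].
by move=> /(_ i j) /eqP; rewrite !mxE !eqxx mul1r (negPf ji) mul0r (negPf (fv j)).
Qed.

Lemma base_vec_inj i j : collinear (base_vec K i) (base_vec K j) -> i = j.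
Proof.
have [//|ij /(_ i j)/eqP] := eqVneq i j.
by rewrite !mxE !eqxx [j == i]eq_sym (negPf ij) mul0r mulr1 oner_eq0.
Qed.

End Collinear.

(** * Distinctness of the orbit points when their coordinates do not vanish *)

Section Generic.
Variables (K : numFieldType) (M : 'M[K]_3).
Hypotheses (uM : M \in unitmx).
Hypothesis q_full : forall i k, full (sigma_orbit M i k).
Hypothesis y_full : forall i k, full (sigma_orbit (invmx M) i k).

Let p i k := orbit_point M 1%:M true i k.
Let q i k := orbit_point M 1%:M false i k.

Let q_orbit i k : q i k = sigma_orbit M i k.
Proof.
rewrite /q /orbit_point /base_point !invmx1 !invmxK.
by apply: eq_iter => v; rewrite mul1mx.
Qed.

Let p0 i : p i 0 = base_vec K i.
Proof. by rewrite /p /orbit_point /base_point /= invmx1 mul1mx. Qed.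

Let pS i k : p i k.+1 = sigma_vec (sigma_orbit (invmx M) i k).
Proof.
elim: k => [|k IHk].
  by rewrite /p /orbit_point /base_point /= invmx1 !mul1mx.
rewrite /p /orbit_point /base_point iterS -/(base_point _ _ _ _).
rewrite -/(orbit_point M 1%:M true i k.+1) -/(p _ _) IHk invmx1 mul1mx.
by rewrite /sigma_orbit iterS.
Qed.

Let p_neq0 i k : p i k != 0.
Proof. by case: k => [|k]; rewrite ?p0 ?base_vec_neq0 // pS; apply/full_neq0/full_sig. Qed.

Let q_neq0 i k : q i k != 0.
Proof. by rewrite q_orbit; apply: full_neq0. Qed.

Let F v := M *m sigma_vec v.

Let sig_sig_full (v : 'cV[K]_3) : full v ->
  exists2 c, c != 0 & sigma_vec (sigma_vec v) = c *: v.
Proof. by move=> fv; rewrite sig_sig; eexists; [|reflexivity]; rewrite !mulf_neq0. Qed.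

Let pF i k : exists2 c, c != 0 & F (p i k.+1) = c *: p i k.
Proof.
have E : sigma_orbit (invmx M) i k = invmx M *m p i k.
  by case: k => [|k]; rewrite ?p0 // pS.
have [c c0 Ec] := sig_sig_full (y_full i k); exists c => //.
by rewrite /F pS Ec -scalemxAr E mulKVmx.
Qed.

Let qF i k : F (q i k) = q i k.+1.
Proof. by rewrite !q_orbit. Qed.

Let F_collinear v w : v != 0 -> w != 0 -> sigma_vec v != 0 -> sigma_vec w != 0 ->
  collinear v w -> collinear (F v) (F w).
Proof. by move=> v0 w0 sv sw /(collinear_sig v0 w0); apply: collinear_mx. Qed.

Let sig_p i k : sigma_vec (p i k.+1) != 0.
Proof. by rewrite pS; apply/full_neq0/full_sig/full_sig. Qed.

Let sig_q i k : sigma_vec (q i k) != 0.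
Proof. by rewrite q_orbit; apply/full_neq0/full_sig. Qed.

Let p_full i k : full (p i k.+1).
Proof. by rewrite pS; apply: full_sig. Qed.

(** Applying [F] lowers both indices by one, until a base vector is compared with a base vector or
    with a vector without zero coordinates. *)
Let pp i k j l : collinear (p i k) (p j l) -> i = j /\ k = l.
Proof.
elim: k l => [|k IHk] [|l] H.
- by split=> //; apply: (@base_vec_inj K); rewrite -!p0.
- by move: H; rewrite p0 => /(base_vec_full (p_full j l)).
- by move: H; rewrite p0 => /collinear_sym/(base_vec_full (p_full i k)).
have := F_collinear (p_neq0 _ _) (p_neq0 _ _) (sig_p _ _) (sig_p _ _) H.
have [c c0 ->] := pF i k; have [d d0 ->] := pF j l.
by move=> /(scale_collinear c0 d0)/IHk[-> ->].
Qed.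

Let q_pre i k : exists2 u, q i k = M *m u &
  u = if k is l.+1 then sigma_vec (q i l) else base_vec K i.
Proof. by eexists; [|reflexivity]; case: k => [|k]; rewrite !q_orbit. Qed.

Let mulM_neq0 (w : 'cV[K]_3) : w != 0 -> M *m w != 0.
Proof. by apply: contra_neq => Mw; rewrite -(mulKmx uM w) Mw mulmx0. Qed.

(** Here the indices are lowered by the inverse map: cancel [M], then apply sigma, which is an
    involution up to a nonzero scalar on vectors without zero coordinates. *)
Let qq i k j l : collinear (q i k) (q j l) -> i = j /\ k = l.
Proof.
elim: k l => [|k IHk] l; have [v -> Ev] := q_pre j l.
  have [u -> Eu] := q_pre i 0 => H.
  have u0 : u != 0 by rewrite Eu base_vec_neq0.
  have v0 : v != 0 by rewrite Ev; case: (l) => [|?]; rewrite ?base_vec_neq0 ?sig_q.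
  have := collinear_mx (invmx M) (mulM_neq0 u0) (mulM_neq0 v0) H; rewrite !mulKmx // Eu Ev.
  case: l {Ev H} => [/base_vec_inj|l /base_vec_full[]]; first by [].
  by apply: full_sig; rewrite q_orbit.
have [u -> Eu] := q_pre i k.+1 => H.
have u0 : u != 0 by rewrite Eu sig_q.
have v0 : v != 0 by rewrite Ev; case: (l) => [|?]; rewrite ?base_vec_neq0 ?sig_q.
have := collinear_mx (invmx M) (mulM_neq0 u0) (mulM_neq0 v0) H; rewrite !mulKmx // Eu Ev.
case: l {Ev H} => [/collinear_sym/base_vec_full[]|l].
  by apply: full_sig; rewrite q_orbit.
move=> /(collinear_sig (sig_q _ _) (sig_q _ _)); rewrite !q_orbit.
have [c c0 ->] := sig_sig_full (q_full i k); have [d d0 ->] := sig_sig_full (q_full j l).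
by move=> /(scale_collinear c0 d0); rewrite -!q_orbit => /IHk[-> ->].
Qed.

(** [F] lowers the index of [p] and raises that of [q]; eventually a base vector would be collinear
    to a vector without zero coordinates. *)
Let pq i k j l : ~ collinear (p i k) (q j l).
Proof.
elim: k l => [|k IHk] l H.
  by apply: (@base_vec_full _ i (q j l)); rewrite -?p0 // q_orbit.
have := F_collinear (p_neq0 _ _) (q_neq0 _ _) (sig_p _ _) (sig_q _ _) H.
have [c c0 ->] := pF i k; rewrite qF -[q j l.+1]scale1r.
by move=> /(scale_collinear c0 (oner_neq0 _))/IHk.
Qed.

Lemma generic_of_full : generic M 1%:M.
Proof.
split=> [[] i k|[] i k [] i' k' H]; [exact: p_neq0|exact: q_neq0| | | |].
- by have [-> ->] := pp H.
- by case: (pq H).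
- by case: (pq (collinear_sym H)).
by have [-> ->] := qq H.
Qed.

End Generic.

Lemma alg_independent_generic (K : numFieldType) (M : 'M[K]_3) :
  alg_independent_over_Q (fun k => mxvec M 0 k) -> generic M 1%:M.
Proof.
move=> Mind; apply: generic_of_full (alg_independent_unit Mind) _ _ => i k j.
  exact: orbit_coord_neq0.
exact: inv_orbit_coord_neq0.
Qed.

(** * Rigidity of linear maps *)

Lemma mxvec_index_inj m n (i k : 'I_m) (j l : 'I_n) :
  mxvec_index i j = mxvec_index k l -> (i, j) = (k, l).
Proof.
by move=> E; have := mxvecE (\matrix_(a, b) (a, b)) i j; rewrite E mxvecE !mxE.
Qed.

Section LinearTriples.
Variable K : numFieldType.

Lemma homog1E n (p : {mpoly K[n]}) : p \is 1.-homog ->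
  p = \sum_(j < n) p@_U_(j) *: 'X_j.
Proof.
move=> p1; apply/mpolyP => m; rewrite raddf_sum /=.
under eq_bigr => j _ do rewrite mcoeffZ mcoeffX.
have [/mdeg1P[k /eqP ->]|m1] := boolP (mdeg m == 1%N).
  rewrite (bigD1 k) //= eqxx mulr1 big1 ?addr0 // => j jk.
  by rewrite eq_mnm1 (negPf jk) mulr0.
rewrite (dhomog_nemf_coeff p1 m1) big1 // => j _.
by case: (U_(j)%MM =P m) m1 => [<-|_ _]; rewrite ?mdeg1 ?mulr0.
Qed.

Lemma hdeg1_linear (T : triple K) : hdeg T 1 -> exists Z, T = linear_triple Z.
Proof.
move=> [_ T1]; exists (\matrix_(i, j) (tnth T i)@_U_(j)).
apply: eq_from_tnth => i; rewrite tnth_mktuple {1}(homog1E (T1 i)).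
by apply: eq_bigr => j _; rewrite mxE.
Qed.

Lemma jac_linear (Z : 'M[K]_3) : jac (linear_triple Z) = (\det Z)%:MP.
Proof.
rewrite /jac -det_map_mx; congr (\det _); apply/matrixP => i j.
rewrite !mxE tnth_mktuple raddf_sum (bigD1 j) //= big1 => [|k kj].
  by rewrite mderivZ mderivX mnm1E eqxx scale1r submm mpolyX0 addr0 alg_mpolyC.
by rewrite mderivZ mderivX mnm1E (negPf kj) scale0r scaler0.
Qed.

Lemma teval_comp (S T : triple K) v : teval (triple_comp S T) v = teval S (teval T v).
Proof.
apply/colP => i; rewrite !mxE tnth_comp comp_mpoly_meval.
by apply: meval_eq => j; rewrite mxE.
Qed.

Lemma teval_linear (Z : 'M[K]_3) v : teval (linear_triple Z) v = Z *m v.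
Proof.
apply/colP => i; rewrite !mxE tnth_mktuple rmorph_sum; apply: eq_bigr => j _ /=.
by rewrite mevalZ mevalXU.
Qed.

Lemma teval_scale (c : K) (T : triple K) v :
  teval (scale_triple c%:MP T) v = c *: teval T v.
Proof. by apply/colP => i; rewrite !mxE tnth_mktuple rmorphM /= mevalC. Qed.

End LinearTriples.

Section Rigidity.
Variables (K : numFieldType) (M : 'M[K]_3).
Hypothesis Mind : alg_independent_over_Q (fun k => mxvec M 0 k).

Lemma alg_independent_neq0 i j : M i j != 0.
Proof.
rewrite -(mxvecE M); apply/eqP => E.
have /Mind/eqP : mmap ratr (fun k => mxvec M 0 k) 'X_(mxvec_index i j) = 0.
  by rewrite mmapX mmap1U.
by rewrite -msupp_eq0 msuppX.
Qed.

(** Independence turns the relation into an equality of monomials X_ab X_ki = X_ba X_ik. Since X_ik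
    differs from X_ki, it must be X_ab. *)
Lemma alg_independent_minor i k a b : i != k -> M a b * M k i = M b a * M i k ->
  a = i /\ b = k.
Proof.
move=> ik E; pose x i j : {mpoly rat[3 * 3]} := 'X_(mxvec_index i j).
have /Mind/eqP : mmap ratr (fun k => mxvec M 0 k) (x a b * x k i - x b a * x i k) = 0.
  by rewrite rmorphB !rmorphM /= !mmapX !mmap1U !mxvecE E subrr.
rewrite subr_eq0 /x -!mpolyXD => /eqP.
move=> /(congr1 (mcoeff (U_(mxvec_index b a) + U_(mxvec_index i k))%MM)).
rewrite !mcoeffX eqxx; case: eqP => [/mnmP/(_ (mxvec_index i k))|_ /eqP]; last first.
  by rewrite eq_sym oner_eq0.
rewrite !mnmDE !mnm1E eqxx.
have -> : (mxvec_index k i == mxvec_index i k) = false.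
  by apply/eqP => /mxvec_index_inj[ki _]; rewrite ki eqxx in ik.
by case: eqP => [/mxvec_index_inj[-> ->]//|_]; lia.
Qed.

(* Evaluating at the coordinate points shows that Z is monomial, with entries t_i
   at (i, tau i); then t_i t_k M_(tau i, tau k) = c' M_(i, k) for all i and k, where
   the left factor is symmetric in i and k, hence the relation
   M_(tau i, tau k) M_(k, i) = M_(tau k, tau i) M_(i, k). *)
Lemma rigid_matrix (Z : 'M[K]_3) c : Z \in unitmx -> c != 0 ->
  (forall v, Z *m (M *m sigma_vec v) = c *: (M *m sigma_vec (Z *m v))) ->
  exists2 t, t != 0 & Z = t%:M.
Proof.
move=> uZ c0 H; have uM := alg_independent_unit Mind.
have colZ a b k : a != b -> Z a k * Z b k = 0.
  have : sigma_vec (Z *m base_vec K k) = 0.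
    have s0 : sigma_vec (base_vec K k) = 0.
      apply/colP => i; rewrite !mxE /=.
      by have [->|->|->] := ord3P i; have [->|->|->] := ord3P k;
        rewrite /= ?(mul0r, mulr0).
    have /esym/eqP := H (base_vec K k); rewrite s0 !mulmx0 scaler_eq0 (negPf c0) /=.
    by move=> /eqP Ms; rewrite -(mulKmx uM (sigma_vec _)) Ms mulmx0.
  rewrite /base_vec -colE => /colP s.
  have := s 0; have := s 1; have := s 2%:R; rewrite !mxE /= => s2 s1 s0.
  by have [->|->|->] := ord3P a; have [->|->|->] := ord3P b => // _;
    rewrite ?s0 ?s1 ?s2 // mulrC ?s0 ?s1 ?s2.
have /choice[tau tauP] : forall i, exists j, Z i j != 0.
  move=> i; apply: contrapT => /forallNP Zi.
  have : (Z *m invmx Z) i i = 0.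
    rewrite mxE big1 // => j _; have /negP/negPn/eqP -> := Zi j; exact: mul0r.
  by rewrite mulmxV // mxE eqxx => /eqP; rewrite oner_eq0.
have tau_inj : injective tau.
  move=> a b E; apply/eqP/negPn/negP => /(colZ a b (tau a))/eqP.
  by rewrite mulf_eq0 {2}E !(negPf (tauP _)).
have Z0 i j : j != tau i -> Z i j = 0.
  have [i' ->] : exists i', j = tau i'.
    by exists (invF tau_inj j); rewrite f_invF.
  rewrite (inj_eq tau_inj) => ii; have /eqP := colZ _ _ (tau i') ii.
  by rewrite mulf_eq0 (negPf (tauP i')) => /eqP.
pose t i := Z i (tau i); pose D := t 0 * t 1 * t 2%:R.
have rel i k : t i * t k * M (tau i) (tau k) = c * D * M i k.
  (* A single zero coordinate, at [tau k], makes sigma v the coordinate vector of that index, so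
     that column [tau k] of [M] appears. *)
  pose v : 'cV[K]_3 := \col_j (j != tau k)%:R.
  have sv : sigma_vec v = base_vec K (tau k).
    apply/colP => a; rewrite !mxE /=.
    by have [->|->|->] := ord3P a; have [->|->|->] := ord3P (tau k);
      rewrite /= ?(mul0r, mulr0, mulr1).
  have Zv : Z *m v = \col_i (t i * (i != k)%:R).
    apply/colP => a; rewrite !mxE (bigD1 (tau a)) //= big1 ?addr0; last first.
      by move=> j ja; rewrite Z0 ?mul0r.
    by rewrite mxE (inj_eq tau_inj).
  (* On the left only the product of the two other [t] survives; the factor [t k] completes it to
     [D], independent of k. *)
  have sZv : t k *: sigma_vec (Z *m v) = D *: base_vec K k.
    rewrite Zv; apply/colP => a; rewrite !mxE /D /=.
    by have [->|->|->] := ord3P a; have [->|->|->] := ord3P k; rewrite /=; ring.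
  have := congr1 (fun u => t k *: u) (H v).
  rewrite sv [RHS]scalerA [t k * c]mulrC -[RHS]scalerA [X in _ = c *: X]scalemxAr sZv.
  rewrite /base_vec -!scalemxAr scalerA -!colE.
  move=> /colP /(_ i); rewrite !mxE => <-.
  rewrite (bigD1 (tau i)) //= big1 ?addr0; last by move=> j ja; rewrite Z0 ?mul0r.
  by rewrite mxE -/(t i); ring.
have tn0 i : t i != 0 := tauP i.
have tau_id i : tau i = i.
  have [k ki] : exists k, i != k by exists (i + 1); case: (i) => -[|[|[|]]].
  apply: (proj1 (alg_independent_minor (a := tau i) (b := tau k) ki _)).
  apply: (mulfI (mulf_neq0 (tn0 i) (tn0 k))).
  by rewrite !mulrA rel [in RHS](mulrC (t i)) rel; ring.
have tt i k : t i * t k = c * D.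
  by apply: (mulIf (alg_independent_neq0 i k)); rewrite -rel !tau_id.
exists (t 0); first exact: tn0.
apply/matrixP => i j; rewrite mxE; case: eqP => [<-|/eqP ij]; last first.
  by rewrite mulr0n Z0 // tau_id eq_sym.
rewrite mulr1n -{2}(tau_id i); apply: (mulIf (tn0 0)).
by rewrite -/(t i) !tt.
Qed.

Variable f : Bir K.
Hypothesis rf : rep f (quad M 1%:M).

Lemma linear_commute_id w : commute f w -> bdeg w = 1%N -> w = 1%g.
Proof.
move=> fw w1; have uM := alg_independent_unit Mind.
have u1 : (1%:M : 'M[K]_3) \in unitmx by rewrite unitmx1.
have gM := alg_independent_generic Mind.
(* At degree 1 the bound on the drop is 3 (1 - 1) = 0. *)
have fw2 : bdeg (f * w)%g = (2 * bdeg w)%N.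
  have := degree_drop_bound w 1 uM u1 rf gM; rewrite !big_ord1 /= !expg0 !expg1 !mul1g w1.
  have := bdeg_le rf w 0; rewrite expg0 expg1 mul1g w1.
  by move: (bdeg (f * w)%g) (bdeg (f^-1 * w)%g) => x y; rewrite muln0; lia.
have [c c0 Ec] := stable_commute rf fw fw2.
have := red_hdeg w; rewrite w1 => /hdeg1_linear[Z EZ].
have uZ : Z \in unitmx.
  have := jac_neq0 (rep_birational (rep_red w)).
  by rewrite EZ jac_linear mpolyC_eq0 unitmxE unitfE.
have [v|t t0 Et] := rigid_matrix uZ c0.
  have := congr1 (fun T => teval T v) Ec.
  by rewrite EZ teval_scale (teval_comp (linear_triple Z)) (teval_comp (quad M 1%:M))
    !teval_quad !teval_linear !mul1mx.
apply: (rep_inj (T := triple_id K)); last exact: rep1.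
apply: (@rep_unscale _ _ t%:MP); first by rewrite mpolyC_eq0.
suff <- : red w = scale_triple t%:MP (triple_id K) by exact: rep_red.
rewrite EZ Et; apply: eq_from_tnth => i; rewrite !tnth_mktuple (bigD1 i) //= big1 ?addr0.
  by rewrite mxE eqxx mulr1n mul_mpolyC.
by move=> j ji; rewrite mxE eq_sym (negPf ji) mulr0n scale0r.
Qed.

End Rigidity.

(** * Integer powers and infinite cyclic centralizers *)

Section IntegerPowers.
Variables (G : groupType) (x : G).

Definition zpow (n : int) : G :=
  match n with Posz k => (x ^+ k)%g | Negz k => (x ^- k.+1)%g end.

Lemma zpowD1 n : zpow (n + 1) = (zpow n * x)%g.
Proof.
case: n => [n|[|n]].
- by rewrite -PoszD addn1 /= expgSr.
- by rewrite /= expg1 mulVg.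
have -> : Negz n.+1 + 1 = Negz n by rewrite !NegzE; lia.
by rewrite /= [in RHS]expgS invgM mulgVK.
Qed.

Lemma zpowB1 n : zpow (n - 1) = (zpow n * x^-1)%g.
Proof. by rewrite -[n in RHS](subrK 1) zpowD1 mulgK. Qed.

Lemma zpowD : {morph zpow : m n / m + n >-> (m * n)%g}.
Proof.
move=> m; elim/int_rect => [|n IHn|n IHn]; first by rewrite addr0 mulg1.
  by rewrite -addn1 PoszD addrA !zpowD1 IHn mulgA.
by rewrite -addn1 PoszD opprD addrA !zpowB1 IHn mulgA.
Qed.

Lemma zpow_inj : (forall n, (x ^+ n = 1)%g -> n = 0%N) -> injective zpow.
Proof.
move=> H m n E; apply/eqP; rewrite -subr_eq0; apply/eqP.
have : zpow (m - n) = 1%g.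
  by apply: (mulIg (zpow n)); rewrite -zpowD subrK E mul1g.
case: (m - n) => k /= xk; first by rewrite (H k xk).
by have := H k.+1; rewrite -[(x ^+ _)%g]invgK xk invg1 => /(_ erefl).
Qed.

End IntegerPowers.

Lemma centralizer_cyclic (G : groupType) (x : G) :
  (forall n, (x ^+ n = 1)%g -> n = 0%N) ->
  (forall y, commute x y -> exists n, y = zpow x n) ->
  isomorphic_to_Z (centralizer x).
Proof.
move=> xinf xgen; exists (zpow x); split; first exact: zpowD.
split=> [n _|m n _ _|y /xgen[n ->]]; [|exact: zpow_inj|by exists n].
by case: n => n; rewrite /centralizer /=; [|apply: commuteV]; apply: commuteX (commute_refl x).
Qed.

Theorem proposition5p4 (R : realType) (A : PGL3 R[i]%C)
    (hA : pgl_alg_independent A) :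
  isomorphic_to_Z (centralizer (pgl_bir A * sigma R[i]%C)%g).
Proof.
case: hA => M -> Mind; rewrite pgl_birE.
have uM : val M \in unitmx := valP M.
have u1 : (1%:M : 'M[R[i]%C]_3) \in unitmx by rewrite unitmx1.
set f := (_ * _)%g.
have rf : rep f (quad (val M) 1%:M).
  rewrite /quad linear_triple1 triple_comp1.
  apply: repM; last exact: rep_sigma.
  by exists (birational_linear (valP M)).
have gM := alg_independent_generic Mind.
apply: centralizer_cyclic => [n fn1|g fg].
  have := bdegX uM u1 rf gM n; rewrite fn1 bdeg1.
  by case: n {fn1} => // n; rewrite expnS; lia.
(* The degree-one product commutes with f, hence is the identity, and [h] is f^(a-N). *)
have key N a h : commute f h -> bdeg (f ^+ N * (f^-1 ^+ a * h))%g = 1%N ->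
    h = zpow f (a%:Z - N%:Z).
  move=> fh d1; have fV : commute f f^-1%g by apply/commuteV/commute_refl.
  have w1 := linear_commute_id Mind rf _ d1.
  have -> : h = (f ^+ a * f ^- N)%g.
    have /mulg1_eq E : (f ^+ N * (f^-1 ^+ a * h) = 1)%g.
      apply: w1; apply: commuteM; first exact: commuteX (commute_refl f).
      by apply: commuteM fh; apply: commuteX.
    by rewrite E expVgn mulVKg.
  rewrite zpowD; congr (_ * _)%g.
  by case: N {d1 w1} => [|N] //=; rewrite expg0 invg1.
have [N [a [d1|d1]]] := centralizer_linear uM u1 rf gM fg.
  by exists (a%:Z - N%:Z); apply: key.
exists (- (a%:Z - N%:Z)); have fgV := commuteV fg.
have E := key _ _ _ fgV d1.
have : (g^-1 * zpow f (- (a%:Z - N%:Z)) = 1)%g by rewrite E -zpowD subrr.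
by move=> /mulg1_eq; rewrite invgK.
Qed.
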